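(* The maps $\iota,\mathrm{flat},\Psi,\zeta^{\mathrm{Tri}},\zeta_{\mathrm{FS}}$ restrict to maps $\iota:\mathrm{Tridend}(\mathbb{N}^* )^{\mathrm{conv}}\to\mathrm{Tree}(\mathbb{N}^* )^{\mathrm{conv}}$, $\mathrm{flat}:\mathrm{Tree}(\mathbb{N}^* )^{\mathrm{conv}}\to\mathcal{W}^{\mathrm{conv}}_{\mathbb{N}^*}$, $\Psi:\mathrm{Tridend}(\mathbb{N}^* )^{\mathrm{conv}}\to\mathcal{W}^{\mathrm{conv}}_{\mathbb{N}^*}$, $\zeta^{\mathrm{Tri}}:\mathrm{Tridend}(\mathbb{N}^* )^{\mathrm{conv}}\to\mathcal{S}^{\mathrm{conv}}_{\mathbb{N}^*}$, $\zeta_{\mathrm{FS}}:\mathcal{W}^{\mathrm{conv}}_{\mathbb{N}^*}\to\mathcal{S}^{\mathrm{conv}}_{\mathbb{N}^*}$, and the diagram they form together with $\zeta^T:\mathrm{Tree}(\mathbb{N}^* )^{\mathrm{conv}}\to\mathbb{R}$, $\zeta:\mathcal{W}^{\mathrm{conv}}_{\mathbb{N}^*}\to\mathbb{R}$ and $\mathrm{ev}:\mathcal{S}^{\mathrm{conv}}_{\mathbb{N}^*}\to\mathbb{R}$ commutes; that is, $$\mathrm{flat}\circ\iota=\Psi,\qquad \zeta_{\mathrm{FS}}\circ\Psi=\zeta^{\mathrm{Tri}},\qquad \zeta\circ\mathrm{flat}=\zeta^T,\qquad \mathrm{ev}\circ\zeta_{\mathrm{FS}}=\zeta .$$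
   Context: All vector spaces are over $\mathbb{R}$; $\mathbb{N}^*=\{1,2,\dots\}$. **Tridendriform algebras.** A tridendriform algebra is a vector space $A$ with bilinear operations $\prec,\cdot,\succ$ such that, with $x*y:=x\prec y+x\cdot y+x\succ y$, for all $x,y,z\in A$: $(x\prec y)\prec z=x\prec(y*z)$; $(x\succ y)\prec z=x\succ(y\prec z)$; $(x*y)\succ z=x\succ(y\succ z)$; $(x\succ y)\cdot z=x\succ(y\cdot z)$; $(x\prec y)\cdot z=x\cdot(y\succ z)$; $(x\cdot y)\prec z=x\cdot(y\prec z)$; $(x\cdot y)\cdot z=x\cdot(y\cdot z)$. ''Tridendriform algebra'' always means the augmented one $\overline A=A\oplus\mathbb{R}1$, with $1\prec a=0=a\succ1$, $a\prec1=a=1\succ a$, $a\cdot1=0=1\cdot a$ for $a\in A$ (and $1*1=1$). A morphism is a linear map sending $1$ to $1$, $A$ to $B$, and preserving $\prec,\succ,\cdot$ on $A$. **Words.** $\mathcal{W}_{\mathbb{N}^*}$ has basis the finite words on $\mathbb{N}^*$, unit the empty word $\emptyset$. The quasi-shuffle $\star_q$ is defined by $u\star_q\emptyset=\emptyset\star_q u=u$ and, for nonempty $u=u_1\cdots u_n$, $v=v_1\cdots v_k$, $u\star_q v=u\prec v+u\succ v+u\cdot v$ with $u\prec v=u_1(u_2\cdots u_n\star_q v)$, $u\succ v=v_1(u\star_q v_2\cdots v_k)$, $u\cdot v=(u_1+v_1)(u_2\cdots u_n\star_q v_2\cdots v_k)$. It is a tridendriform algebra. $\mathcal{W}^{\mathrm{conv}}_{\mathbb{N}^*}$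 is the span of $\emptyset$ and the words not starting with $1$. The linear map $\zeta:\mathcal{W}^{\mathrm{conv}}_{\mathbb{N}^*}\to\mathbb{R}$ is $\zeta(w_1\cdots w_k)=\sum_{1\le n_k<\dots<n_1}\prod_{i=1}^k n_i^{-w_i}$, $\zeta(\emptyset)=1$. **Quasi-shuffles.** For $k,l\ge1$, $\mathrm{Qsh}(k,l)$ is the set of surjections $\sigma:\{1,\dots,k+l\}\to\{1,\dots,n\}$ (some $n=\max(\sigma)$) with $\sigma(1)<\dots<\sigma(k)$ and $\sigma(k+1)<\dots<\sigma(k+l)$. **Formal series.** For $d\in\mathbb{N}$, $\mathbb{R}\mathcal{P}(\mathbb{N}^d)$ is the vector space with basis the power set of $\mathbb{N}^d$, an algebra for $\cup$, and $J_d$ its ideal generated by all $A\cup B-A-B+A\cap B$. Fix $F:k\mapsto f_k=(n\mapsto n^{-k})$. A formal series $A\otimes w\times F$, also written $\sum_A\prod_i f_{w_i}$, is a pair consisting of an element of $\langle(\mathbb{R}\mathcal{P}(\mathbb{N}^{\ell(w)})/J_{\ell(w)})\otimes w\mid w\text{ a word}\rangle$ ($\ell$ = length) and of $F$; vector space operations are those of the first component. $\mathcal{S}_{\mathbb{N}^*}$ is the span of all $\sum_{1\le n_r<\dots<n_1}\prod_{i=1}^r f_{\omega_i}:=\{(n_1,\dots,n_r):1\le n_r<\dots<n_1\}\otimes\omega_1\cdots\omega_r\times F$, $r\ge0$ (for $r=0$: $\emptyset\otimes\emptyset\times F$, the unit). For $\alpha=\sum_{1\le n_k<\dots<n_1}\prod_{i=1}^k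 f_{\omega_i}$, $\beta=\sum_{1\le n_{k+l}<\dots<n_{k+1}}\prod_{i=k+1}^{k+l}f_{\omega_i}$ ($k,l\ge1$), each of $\alpha\prec\beta,\alpha\succ\beta,\alpha\cdot\beta$ is $\sum_\sigma\sum_{1\le n_{\max(\sigma)}<\dots<n_1}\prod_i f_{\omega_{\sigma^{-1}(\{i\})}}$ over $\sigma\in\mathrm{Qsh}(k,l)$ with, respectively, $\sigma^{-1}(\{1\})=\{1\},\{k+1\},\{1,k+1\}$, where $\omega_{\{i\}}=\omega_i$ and $\omega_{\{i,j\}}=\omega_i+\omega_j$. It is a tridendriform algebra. $\zeta_{\mathrm{FS}}:\mathcal{W}_{\mathbb{N}^*}\to\mathcal{S}_{\mathbb{N}^*}$ is the linear map $\omega_1\cdots\omega_k\mapsto\sum_{1\le n_k<\dots<n_1}\prod_{i=1}^k f_{\omega_i}$, $\emptyset\mapsto\emptyset\otimes\emptyset\times F$. $\mathcal{S}^{\mathrm{conv}}_{\mathbb{N}^*}$ is the span of those spanning elements $A\otimes\omega\times F$ of $\mathcal{S}_{\mathbb{N}^*}$ with $\omega=\emptyset$ or first letter of $\omega$ different from $1$; $\mathrm{ev}$ is the linear map sending such $A\otimes\omega_1\cdots\omega_k\times F$ to the real number $\sum_{(n_1,\dots,n_k)\in A}\prod_{i=1}^k f_{\omega_i}(n_i)$, and the unit to $1$. **Schroeder trees.** A Schroeder tree is a planar rooted tree each of whose internal (non-leaf) vertices has at least two children; $|$ is the tree with no internal vertex. An angle of an internal vertex $v$ is a pair of consecutive (left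 to right) edges from $v$ to its children. $\nu(t)$ is the set of internal vertices of $t$. $\mathrm{Tridend}(\mathbb{N}^* )$ is the vector space with basis the Schroeder trees with all angles decorated by elements of $\mathbb{N}^*$. $Y_n$ denotes the tree with one internal vertex, two leaves, angle decorated by $n$. **Products on $\mathrm{Tridend}(\mathbb{N}^* )$.** For trees $t,s\neq|$, let $v_1$ (the root), $\dots,v_k$ be the internal vertices on the rightmost branch of $t$, $F_i$ the ordered forest of subtrees at all children of $v_i$ except the rightmost one, $w_i$ the word of decorations of the angles of $v_i$; let $v_{k+1}$ (the root), $\dots,v_{k+l}$ be the internal vertices on the leftmost branch of $s$, $F_{k+i}$ the forest of subtrees at all children of $v_{k+i}$ except the leftmost one, $w_{k+i}$ the word of its angle decorations. For $\sigma\in\mathrm{Qsh}(k,l)$ with image $\{1,\dots,n\}$, $\sigma(t,s)$ is obtained from the ladder with nodes $1$ (root), $\dots,n$, ended above by a leaf, by grafting $F_i$ to the left of the ladder at node $\sigma(i)$ for $i\le k$ and $F_i$ to the right at node $\sigma(i)$ for $i>k$, keeping decorations of the $F_i$, and decorating the angles of node $m$ left to right by $w_i$ if $\sigma^{-1}(\{m\})=\{i\}$ and by the concatenation $w_iw_j$ if $\sigma^{-1}(\{m\})=\{i,j\}$, $i\le k<j$. Then $t\prec s$, $t\succ s$, $t\cdot s$ are the sums of $\sigma(t,s)$ over $\sigma\in\mathrm{Qsh}(k,l)$ with $\sigma^{-1}(\{1\})=\{1\}$, $\{k+1\}$, $\{1,k+1\}$ respectively; $|$ is the unit. It is known that $\mathrm{Tridend}(\mathbb{N}^*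 )$ is the free tridendriform algebra on $\mathbb{N}^*$ via $n\mapsto Y_n$. $\mathrm{Tridend}(\mathbb{N}^* )^{\mathrm{conv}}$ is the span of the convergent trees: $|$ and the trees whose root does not have a unique angle decorated by $1$ (i.e. it is not the case that the root has exactly one angle and this angle is decorated by $1$). **Maps.** $\Psi:\mathrm{Tridend}(\mathbb{N}^* )\to\mathcal{W}_{\mathbb{N}^*}$ is the unique tridendriform morphism with $\Psi(Y_n)=n$ (one-letter word). $\zeta^{\mathrm{Tri}}:\mathrm{Tridend}(\mathbb{N}^* )\to\mathcal{S}_{\mathbb{N}^*}$ is the unique tridendriform morphism with $\zeta^{\mathrm{Tri}}(Y_n)=\sum_{1\le k}f_n$. $\mathrm{Tree}(\mathbb{N}^* )$ is the vector space with basis the Schroeder trees whose internal vertices $v$ are decorated by elements $n_v\in\mathbb{N}^*$ that are at least the number of angles of $v$. $\iota:\mathrm{Tridend}(\mathbb{N}^* )\to\mathrm{Tree}(\mathbb{N}^* )$ is the linear map keeping the tree and decorating each internal vertex by the sum of the decorations of its angles. $\mathrm{flat}:\mathrm{Tree}(\mathbb{N}^* )\to\mathcal{W}_{\mathbb{N}^*}$ is the linear map with $\mathrm{flat}(|)=\emptyset$ and, for $t$ with root decorated by $n$ and subtrees $t_1,\dots,t_k$ at the children of the root, $\mathrm{flat}(t)=n(\mathrm{flat}(t_1)\star_q\cdots\star_q\mathrm{flat}(t_k))$. $\mathrm{Tree}(\mathbb{N}^* )^{\mathrm{conv}}$ is the span of $|$ and the trees whose root is not decorated by $1$. $\zeta^T:\mathrm{Tree}(\mathbb{N}^*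 )^{\mathrm{conv}}\to\mathbb{R}$ is the linear map given on trees by $$\zeta^T(t)=\sum_{(k_v)\in D_t}\ \prod_{v\in\nu(t)}\frac1{k_v^{n_v}},\quad D_t=\{(k_v)_{v\in\nu(t)}\in(\mathbb{N}^* )^{\nu(t)}: k_v<k_w\text{ whenever }w\text{ is a strict ancestor of }v\}$$ (so $\zeta^T(|)=1$). *)

(* Defs.v *)
From HB Require Import structures.
From mathcomp Require Import all_boot all_order all_algebra.
From mathcomp Require Import finmap boolp classical_sets functions reals ereal esum.
(* The reserved notations of monalg clash with those of mathcomp-classical, so
   {malg R[K]} is written malg K R, and << k >> is written bas R k. *)
From mathcomp Require Import -(notations) monalg.

Set Implicit Arguments.
Unset Strict Implicit.
Unset Printing Implicit Defensive.
Import Order.TTheory GRing.Theory Num.Theory.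
Local Open Scope classical_set_scope.
Local Open Scope ring_scope.
Local Open Scope quotient_scope.

Section LinearAlgebra.
Variable R : realType.

Definition bas (K : choiceType) (k : K) : malg K R := mkmalgU k 1.

Definition lin_ext (K : choiceType) (V : lmodType R) (f : K -> V)
  (x : malg K R) : V := \sum_(k <- msupp x) mcoeff k x *: f k.

(* The coordinates of x along the family b, when x lies in the span of b.  They
   are chosen classically, and are unique when b is linearly independent. *)
Definition coords (K : choiceType) (V : lmodType R) (b : K -> V) (x : V) :
  malg K R := xget 0 [set c | lin_ext b c = x].

Definition bilin_ext (K : choiceType) (V : lmodType R) (b : K -> V)
    (f : K -> K -> V) (x y : V) : V :=
  lin_ext (fun u => lin_ext (f u) (coords b y)) (coords b x).

Definition subspace (V : lmodType R) (U : set V) : Prop :=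
  U 0 /\ forall a x y, U x -> U y -> U (a *: x + y).

Definition lspan (V : lmodType R) (X : set V) : set V := smallest (@subspace V) X.

Lemma lspan_subspace (V : lmodType R) (X : set V) : subspace (lspan X).
Proof.
split=> [U [[U0 _] _] //|a x y hx hy U UX].
by apply: UX.1.2; [apply: hx | apply: hy].
Qed.

End LinearAlgebra.
Arguments bas R {K} k.

(* The data of an augmented tridendriform algebra A + R.1 inside an ambient
   vector space, which may be larger than A + R.1.  The tridendriform identities
   play no role in the notion of morphism, and are not recorded. *)
Record augTridend (R : realType) := AugTridend {
  at_space :> lmodType R;
  at_unit : at_space;
  at_aug : set at_space;
  at_prec : at_space -> at_space -> at_space;
  at_succ : at_space -> at_space -> at_space;
  at_dot : at_space -> at_space -> at_space }.
Arguments at_unit {R} A : rename.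
Arguments at_aug {R} A x : rename.
Arguments at_prec {R} {A} x y : rename.
Arguments at_succ {R} {A} x y : rename.
Arguments at_dot {R} {A} x y : rename.

Record tridend_morphism (R : realType) (A B : augTridend R) (f : A -> B) :
    Prop := TridendMorphism {
  tm_linear : forall (a : R) (x y : A), f (a *: x + y) = a *: f x + f y;
  tm_unit : f (at_unit A) = at_unit B;
  tm_aug : forall x, at_aug A x -> at_aug B (f x);
  tm_prec : forall x y, at_aug A x -> at_aug A y ->
    f (at_prec x y) = at_prec (f x) (f y);
  tm_succ : forall x y, at_aug A x -> at_aug A y ->
    f (at_succ x y) = at_succ (f x) (f y);
  tm_dot : forall x y, at_aug A x -> at_aug A y ->
    f (at_dot x y) = at_dot (f x) (f y) }.

(* The augmented algebra with linear basis b, where b e is the unit: prec, succ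
   and dot give the products of the basis elements other than the unit.  The
   three products of the unit with itself, which are undefined, are 0. *)
Definition tridend_on (R : realType) (K : choiceType) (V : lmodType R)
    (b : K -> V) (e : K) (prec succ dot : K -> K -> V) : augTridend R :=
  @AugTridend R V (b e) (lspan [set b k | k in [set k | k != e]])
    (bilin_ext b (fun x y =>
       if x == e then 0 else if y == e then b x else prec x y))
    (bilin_ext b (fun x y =>
       if y == e then 0 else if x == e then b y else succ x y))
    (bilin_ext b (fun x y =>
       if (x == e) || (y == e) then 0 else dot x y)).

Definition posnat := {n : nat | (0 < n)%N}.

Lemma paddP (m n : posnat) : (0 < val m + val n)%N.
Proof. by rewrite addn_gt0 (valP m). Qed.

Definition padd (m n : posnat) : posnat := Sub (val m + val n)%N (paddP m n).

Definition pone : posnat := Sub 1%N isT.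

(* Sum of a nonempty word; pone is a junk value for the empty word. *)
Definition psum (w : seq posnat) : posnat :=
  if w is a :: w' then foldl padd a w' else pone.

Definition word := seq posnat.

Notation Words R := (malg word R).

Section Words.
Variable R : realType.

Definition wcons (a : posnat) : Words R -> Words R :=
  lin_ext (fun w => bas R (a :: w)).

Fixpoint qshuffle (u : word) : word -> Words R :=
  fix aux (v : word) : Words R :=
    match u, v with
    | [::], _ => bas R v
    | _, [::] => bas R u
    | a :: u', b :: v' =>
        wcons a (qshuffle u' v) + wcons b (aux v')
        + wcons (padd a b) (qshuffle u' v')
    end.

Definition star (x y : Words R) : Words R :=
  lin_ext (fun u => lin_ext (qshuffle u) y) x.

Definition wprec (u v : word) : Words R :=
  if u is a :: u' then wcons a (qshuffle u' v) else 0.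
Definition wsucc (u v : word) : Words R :=
  if v is b :: v' then wcons b (qshuffle u v') else 0.
Definition wdot (u v : word) : Words R :=
  if (u, v) is (a :: u', b :: v') then wcons (padd a b) (qshuffle u' v') else 0.

Definition words_tridend : augTridend R :=
  tridend_on (@bas R word) [::] wprec wsucc wdot.

Definition conv_word (w : word) : bool := if w is a :: _ then val a != 1%N else true.

Definition Words_conv : set (Words R) :=
  lspan [set bas R w | w in [set w : word | conv_word w]].

End Words.

(* The quasi-shuffles are indexed from 0: the first block is 0, ..., k - 1, and the
   second one is k, ..., k + l - 1. *)
Definition is_qsh (k l n : nat) (s : {ffun 'I_(k + l) -> 'I_n}) : bool :=
  [&& [forall i : 'I_k, forall j : 'I_k,
         (i < j)%N ==> (s (lshift l i) < s (lshift l j))%N],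
      [forall i : 'I_l, forall j : 'I_l,
         (i < j)%N ==> (s (rshift k i) < s (rshift k j))%N]
    & [forall m, exists i, s i == m]].

Definition Qsh (k l n : nat) := {s : {ffun 'I_(k + l) -> 'I_n} | is_qsh s}.

(* The elements of the fiber s^-1(m), in increasing order. *)
Definition fiber (k l n : nat) (s : Qsh k l n) (m : 'I_n) : seq nat :=
  [seq val i | i <- enum 'I_(k + l) & val s i == m].

(* Sum over the quasi-shuffles s of k and l such that s^-1({0}) = P. *)
Definition qsh_sum (V : nmodType) (k l : nat) (P : pred nat)
    (F : forall n, Qsh k l n -> V) : V :=
  \sum_(n < (k + l).+1)
    \sum_(s : Qsh k l n | [forall i, (val s i == 0 :> nat) == P i]) F n s.

Definition qprec (k : nat) : pred nat := [pred i | i == 0]%N.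
Definition qsucc (k : nat) : pred nat := [pred i | i == k].
Definition qdot (k : nat) : pred nat := [pred i | (i == 0%N) || (i == k)].

Definition pset (d : nat) := set (d.-tuple nat).
HB.instance Definition _ d := Choice.on (pset d).

Section PsetMonoid.
Variable d : nat.
Implicit Types A B C : pset d.

Fact pset_unit A B : A `|` B = set0 -> A = set0 /\ B = set0.
Proof. by rewrite setU_eq0. Qed.

HB.instance Definition _ := Choice_isMonomialDef.Build (pset d)
  (@setUA (d.-tuple nat)) (@set0U (d.-tuple nat)) (@setU0 (d.-tuple nat))
  pset_unit.
HB.instance Definition _ := MonomialDef_isConomialDef.Build (pset d)
  (@setUC (d.-tuple nat)).

End PsetMonoid.

Section FormalSeries.
Variable R : realType.

(* malg (pset d) R is the vector space with basis the power set of N^d, with the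
   product that extends the union. *)
Definition ideal (A : lalgType R) (I : set A) : Prop :=
  [/\ I 0, forall x y, I x -> I y -> I (x + y) & forall a x, I x -> I (a * x)].

Definition modular_ideal (d : nat) : set (malg (pset d) R) :=
  smallest (@ideal (malg (pset d) R))
    [set x | exists A B : pset d, x = bas R (A `|` B : pset d) - bas R A - bas R B
                                      + bas R (A `&` B : pset d)].
Arguments modular_ideal d : clear implicits.

(* The direct sum over words w of (span of the power set of N^(size w)) (x) w. *)
Notation preFS := (malg {w : word & pset (size w)} R).

Definition preFS_in (w : word) : malg (pset (size w)) R -> preFS :=
  lin_ext (fun A => bas R (Tagged (fun w => pset (size w)) A)).

Definition FS_rel : set preFS :=
  lspan [set y | exists w, exists2 x, modular_ideal (size w) x
                                    & y = preFS_in x].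

Definition FS_relb : {pred preFS} := fun x => `[< FS_rel x >].

Fact FS_rel_zmod_closed : zmod_closed FS_relb.
Proof.
have [h0 hD] := lspan_subspace [set y | exists w,
  exists2 x, modular_ideal (size w) x & y = preFS_in x].
split=> [|x y /asboolP hx /asboolP hy]; apply/asboolP => //.
by rewrite addrC -scaleN1r; apply: hD.
Qed.
HB.instance Definition _ := GRing.isZmodClosed.Build preFS FS_relb FS_rel_zmod_closed.

Definition FS := Quotient.quot FS_relb.
HB.instance Definition _ := GRing.Zmodule.on FS.


Definition FS_scale (a : R) (x : FS) : FS := \pi_FS (a *: repr x).

Fact pi_FS_scale (a : R) (x : preFS) : \pi_FS (a *: x) = FS_scale a (\pi_FS x).
Proof.
have [h0 hD] := lspan_subspace [set y | exists w,
  exists2 x, modular_ideal (size w) x & y = preFS_in x].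
apply/eqP; rewrite -Quotient.idealrBE -scalerBr.
have /asboolP h : x - repr (\pi_FS x) \in FS_relb.
  by rewrite Quotient.idealrBE reprK.
by apply/asboolP; rewrite -[_ *: _]addr0; apply: hD.
Qed.

Fact FS_scaleA a b x : FS_scale a (FS_scale b x) = FS_scale (a * b) x.
Proof.
by rewrite -[x]reprK -(pi_FS_scale b) -(pi_FS_scale a) -pi_FS_scale scalerA.
Qed.

Fact FS_scale1 : left_id 1 FS_scale.
Proof. by move=> x; rewrite -[x]reprK -pi_FS_scale scale1r. Qed.

Fact FS_scaleDr : right_distributive FS_scale +%R.
Proof.
move=> a x y; rewrite -[x]reprK -[y]reprK -!(pi_FS_scale a).
by rewrite -!raddfD /= -pi_FS_scale scalerDr.
Qed.

Fact FS_scaleDl x : {morph FS_scale^~ x : a b / a + b}.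
Proof.
move=> a b; rewrite -[x]reprK -(pi_FS_scale (a + b)) -(pi_FS_scale a).
by rewrite -(pi_FS_scale b) -raddfD /= scalerDl.
Qed.

HB.instance Definition _ := GRing.Zmodule_isLmodule.Build R FS
  FS_scaleA FS_scale1 FS_scaleDr FS_scaleDl.

(* The formal series A (x) w x F.  The second component of the pair is always
   the fixed family F, and only the first one is kept. *)
Definition fs_tensor (w : word) (A : pset (size w)) : FS :=
  \pi_FS (bas R (Tagged (fun w => pset (size w)) A) : preFS).

(* The sequences n_1 > ... > n_d >= 1. *)
Definition chains (d : nat) : pset d :=
  [set n | sorted gtn n && all (leq 1) n].
#[global] Arguments chains d : clear implicits.

(* The unit of the formal series is (empty set) (x) (empty word) x F. *)
Definition fs_region (w : word) : pset (size w) :=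
  if w == [::] then set0 else chains (size w).
#[global] Arguments fs_region w : clear implicits.

Definition fs_gen (w : word) : FS := fs_tensor (fs_region w).

Definition fs_qsh (P : nat -> pred nat) (u v : word) : FS :=
  qsh_sum (k := size u) (l := size v) (P (size u)) (fun n s =>
    fs_gen [seq psum [seq nth pone (u ++ v) i | i <- fiber s m]
           | m <- enum 'I_n]).

(* The subspace spanned by the fs_gen w, inside FS. *)
Definition S_tridend : augTridend R :=
  tridend_on fs_gen [::] (fs_qsh qprec) (fs_qsh qsucc) (fs_qsh qdot).

Definition S_conv : set FS :=
  lspan [set fs_gen w | w in [set w : word | conv_word w]].

Definition zetaFS : Words R -> FS := lin_ext fs_gen.

End FormalSeries.

Section Zeta.
Variable R : realType.

Definition fseries (k : posnat) (n : nat) : R := (n%:R ^+ val k)^-1.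

Definition fseries_prod (w : word) (n : (size w).-tuple nat) : R :=
  \prod_(i < size w) fseries (tnth (in_tuple w) i) (tnth n i).

Definition zeta_word (w : word) : R :=
  fine (\esum_(n in chains (size w)) (fseries_prod n)%:E).

Definition zeta : Words R -> R := lin_ext (V := R^o) zeta_word.

Definition ev_gen (w : word) : R :=
  if w == [::] then 1 else fine (\esum_(n in fs_region w) (fseries_prod n)%:E).

(* Only meaningful on S_conv; zeta and zetaT are likewise only meaningful on
   Words_conv and Tree_conv. *)
Definition ev (x : FS R) : R :=
  lin_ext (V := R^o) ev_gen (coords (@fs_gen R) x).

End Zeta.

Inductive ptree (D : Type) := Leaf | Node of D & seq (ptree D).
Arguments Leaf {D}.

Section PTreeInd.
Variables (D : Type) (P : ptree D -> Prop).
Hypothesis P_leaf : P Leaf.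
Hypothesis P_node :
  forall d ts, foldr (fun t Q => P t /\ Q) True ts -> P (Node d ts).

Fixpoint ptree_nested_ind (t : ptree D) : P t :=
  match t with
  | Leaf => P_leaf
  | Node d ts => P_node d
      ((fix aux ts : foldr (fun t Q => P t /\ Q) True ts :=
         match ts with
         | [::] => I
         | t :: ts' => conj (ptree_nested_ind t) (aux ts')
         end) ts)
  end.
End PTreeInd.

Section PTreeChoice.
Variable D : Type.

Fixpoint ptree_encode (t : ptree D) : GenTree.tree D :=
  match t with
  | Leaf => GenTree.Node 0 [::]
  | Node d ts => GenTree.Node 1 (GenTree.Leaf d :: map ptree_encode ts)
  end.

Fixpoint ptree_decode (t : GenTree.tree D) : option (ptree D) :=
  match t with
  | GenTree.Node 1 (GenTree.Leaf d :: ts) =>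
      Some (Node d (pmap ptree_decode ts))
  | _ => Some Leaf
  end.

Lemma ptree_encodeK : pcancel ptree_encode ptree_decode.
Proof.
elim/ptree_nested_ind => //= d ts IH; congr (Some (Node d _)).
by elim: ts IH => //= t ts IHts [-> /IHts ->].
Qed.
End PTreeChoice.

HB.instance Definition _ (D : eqType) :=
  Equality.copy (ptree D) (pcan_type (@ptree_encodeK D)).
HB.instance Definition _ (D : choiceType) :=
  Choice.copy (ptree D) (pcan_type (@ptree_encodeK D)).

Fixpoint schroeder (D : Type) (t : ptree D) : bool :=
  if t is Node _ ts then (2 <= size ts)%N && all (@schroeder D) ts else true.

(* A vertex with k + 1 children has k angles: the decorations of the angles of
   a vertex, from left to right, are encoded as a word that decorates it. *)
Fixpoint angle_deco (t : ptree word) : bool :=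
  if t is Node w ts then (size ts == (size w).+1) && all angle_deco ts else true.

Fixpoint vertex_deco (t : ptree posnat) : bool :=
  if t is Node n ts then ((size ts).-1 <= val n)%N && all vertex_deco ts else true.

Definition tri_wf (t : ptree word) : bool := schroeder t && angle_deco t.
Definition vtree_wf (t : ptree posnat) : bool := schroeder t && vertex_deco t.

Definition tritree := {t : ptree word | tri_wf t}.
Definition vtree := {t : ptree posnat | vtree_wf t}.


Notation Tridend R := (malg tritree R).
Notation Tree R := (malg vtree R).

Definition tri_leaf : tritree := Sub Leaf isT.
Definition vtree_leaf : vtree := Sub Leaf isT.
Definition triY (n : posnat) : tritree := Sub (Node [:: n] [:: Leaf; Leaf]) isT.

(* The pairs (w_i, F_i) along the rightmost and the leftmost branches, from the
   root. *)
Fixpoint rbranch (t : ptree word) : seq (word * seq (ptree word)) :=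
  if t is Node w ts
  then (w, take (size ts).-1 ts) :: last [::] (map rbranch ts) else [::].

Fixpoint lbranch (t : ptree word) : seq (word * seq (ptree word)) :=
  if t is Node w ts then (w, behead ts) :: head [::] (map lbranch ts) else [::].

Definition branches (t s : ptree word) := rbranch t ++ lbranch s.

Definition graft (t s : ptree word) (n : nat)
    (q : Qsh (size (rbranch t)) (size (lbranch s)) n) : ptree word :=
  let w i := (nth ([::], [::]) (branches t s) i).1 in
  let F i := (nth ([::], [::]) (branches t s) i).2 in
  foldr (fun m above =>
    Node (flatten [seq w i | i <- fiber q m])
      (flatten [seq F i | i <- fiber q m & (i < size (rbranch t))%N]
       ++ above
       :: flatten [seq F i | i <- fiber q m & (size (rbranch t) <= i)%N]))
    Leaf (enum 'I_n).

Definition branch_wf (b : word * seq (ptree word)) : bool :=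
  [&& (0 < size b.1)%N, size b.2 == size b.1 & all tri_wf b.2].

Lemma tri_wf_node w ts :
  tri_wf (Node w ts) =
  [&& (2 <= size ts)%N, size ts == (size w).+1 & all tri_wf ts].
Proof.
rewrite /tri_wf /=.
have -> : all (fun t => schroeder t && angle_deco t) ts
          = all (@schroeder _) ts && all angle_deco ts.
  by elim: ts => //= t ts ->; case: schroeder; case: angle_deco; case: all.
by case: (2 <= _)%N; case: (_ == _); case: all.
Qed.

Lemma rbranch_wf t : tri_wf t -> all branch_wf (rbranch t).
Proof.
elim/ptree_nested_ind: t => // w ts IH.
rewrite tri_wf_node => /and3P[h2 /eqP hs hall] /=; apply/andP; split.
  rewrite /branch_wf /= size_take hs ltnS leqnn eqxx -ltnS -hs h2 /=.
  by apply/allP => x /mem_take /(allP hall).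
case: (lastP ts) IH hall => //= {h2 hs} ts t IH; rewrite all_rcons => /andP[ht _].
rewrite map_rcons last_rcons.
suff /(_ ht) : tri_wf t -> all branch_wf (rbranch t) by [].
by elim: ts IH => [|a ts IHts] /= [].
Qed.

Lemma lbranch_wf t : tri_wf t -> all branch_wf (lbranch t).
Proof.
elim/ptree_nested_ind: t => // w ts IH.
rewrite tri_wf_node => /and3P[h2 /eqP hs hall] /=; apply/andP; split.
  rewrite /branch_wf /= size_behead hs eqxx -ltnS -hs h2 /=.
  by apply/allP => x /mem_behead /(allP hall).
by case: ts IH hall {h2 hs} => //= t ts [IH _] /andP[/IH].
Qed.

Lemma graft_wf t s n (q : Qsh (size (rbranch t)) (size (lbranch s)) n) :
  tri_wf t -> tri_wf s -> tri_wf (graft q).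
Proof.
move=> /rbranch_wf ht /lbranch_wf hs; rewrite /graft.
set bs := branches t s; set k := size (rbranch t).
have hb i : (i < k + size (lbranch s))%N -> branch_wf (nth ([::], [::]) bs i).
  have /allP h : all branch_wf bs by rewrite all_cat ht.
  by move=> hi; apply: h; apply: mem_nth; rewrite size_cat.
have hsz i : size (nth ([::], [::]) bs i).2 = size (nth ([::], [::]) bs i).1.
  have [/hb /and3P[_ /eqP] //|hi] := ltnP i (k + size (lbranch s)).
  by rewrite nth_default ?size_cat.
have hwf i : all tri_wf (nth ([::], [::]) bs i).2.
  have [/hb /and3P[] //|hi] := ltnP i (k + size (lbranch s)).
  by rewrite nth_default ?size_cat.
have hF (r : seq nat) :
    all tri_wf (flatten [seq (nth ([::], [::]) bs i).2 | i <- r]).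
  by elim: r => //= i r IH; rewrite all_cat hwf.
elim: (enum 'I_n) => [|m ms IH] //; rewrite [foldr _ _ _]/= tri_wf_node.
rewrite all_cat /= IH !hF !andbT.
set above := foldr _ _ _ in IH *.
have -> : size (flatten [seq (nth ([::], [::]) bs i).2 | i <- fiber q m & (i < k)%N]
          ++ above :: flatten [seq (nth ([::], [::]) bs i).2
                              | i <- fiber q m & (k <= i)%N])
    = (size (flatten [seq (nth ([::], [::]) bs i).1 | i <- fiber q m])).+1.
  rewrite size_cat /= addnS; congr _.+1.
  elim: (fiber q m) => //= i r; rewrite (leqNgt k i).
  by case: (i < k)%N => /= hr; rewrite !size_cat hsz -hr; [rewrite addnA | rewrite addnCA].
rewrite eqxx andbT ltnS.
have /and3P[_ _ /forallP /(_ m) /existsP[i hi]] := valP q.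
have : val i \in fiber q m by apply: map_f; rewrite mem_filter hi mem_enum.
have /and3P[hi0 _ _] := hb _ (ltn_ord i).
elim: (fiber q m) => //= j r IHr; rewrite inE size_cat => /predU1P[<-|/IHr h].
  exact: ltn_addr.
exact: ltn_addl.
Qed.

Section Tridend.
Variable R : realType.

Definition tri_graft (t s : tritree) n
    (q : Qsh (size (rbranch (val t))) (size (lbranch (val s))) n) : tritree :=
  Sub (graft q) (graft_wf q (valP t) (valP s)).

Definition tri_qsh (P : nat -> pred nat) (t s : tritree) : Tridend R :=
  qsh_sum (P (size (rbranch (val t))))
    (fun n q => bas R (@tri_graft t s n q)).

Definition tri_tridend : augTridend R :=
  tridend_on (@bas R tritree) tri_leaf (tri_qsh qprec) (tri_qsh qsucc) (tri_qsh qdot).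

Definition conv_tritree (t : tritree) : bool :=
  if val t is Node w _ then w != [:: pone] else true.

Definition Tridend_conv : set (Tridend R) :=
  lspan [set bas R t | t in [set t : tritree | conv_tritree t]].

(* There is exactly one such morphism, so that the default value 0 is not used,
   here and in zetaTri. *)
Definition Psi : Tridend R -> Words R :=
  xget (fun=> 0)
    [set f | @tridend_morphism R tri_tridend (words_tridend R) f
             /\ forall n, f (bas R (triY n)) = bas R [:: n]].

Definition zetaTri : Tridend R -> FS R :=
  xget (fun=> 0)
    [set f | @tridend_morphism R tri_tridend (S_tridend R) f
             /\ forall n, f (bas R (triY n)) = fs_gen R [:: n]].

End Tridend.

Fixpoint angle_sums (t : ptree word) : ptree posnat :=
  if t is Node w ts then Node (psum w) (map angle_sums ts) else Leaf.

Lemma psum_ge w : (size w <= val (psum w))%N.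
Proof.
case: w => // a w /=.
have : (1 <= val a)%N by apply: valP.
suff : forall c m, (m <= val c)%N -> (m + size w <= val (foldl padd c w))%N.
  by move=> h /h; rewrite add1n.
elim: w => [|b w IH] c m hc /=; first by rewrite addn0.
by rewrite -addSnnS; apply: IH; rewrite /= -addn1 leq_add //; apply: (valP b).
Qed.

Lemma angle_sums_wf t : tri_wf t -> vtree_wf (angle_sums t).
Proof.
elim/ptree_nested_ind: t => // w ts IH; rewrite tri_wf_node => /and3P[h2 /eqP hs hall].
suff : all vtree_wf (map angle_sums ts).
  rewrite /vtree_wf /= size_map h2 hs /= psum_ge /= => h; apply/andP; split.
    by apply: sub_all h => x /andP[].
  by apply: sub_all h => x /andP[].
by elim: ts IH hall {h2 hs} => //= t ts IHts [IH /IHts h] /andP[/IH -> /h].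
Qed.

Definition iota_tree (t : tritree) : vtree :=
  Sub (angle_sums (val t)) (angle_sums_wf (valP t)).

Section Tree.
Variable R : realType.

Definition iota_map : Tridend R -> Tree R :=
  lin_ext (fun t => bas R (iota_tree t)).

Fixpoint flat_ptree (t : ptree posnat) : Words R :=
  if t is Node n ts
  then wcons n (foldr (@star R) (bas R [::]) (map flat_ptree ts))
  else bas R [::].

Definition flat : Tree R -> Words R := lin_ext (fun t => flat_ptree (val t)).

Definition conv_vtree (t : vtree) : bool :=
  if val t is Node n _ then n != pone else true.

Definition Tree_conv : set (Tree R) :=
  lspan [set bas R t | t in [set t : vtree | conv_vtree t]].

(* The internal vertices of t, as pairs of an address (the positions of the
   children to follow from the root) and a decoration. *)
Fixpoint vertices (t : ptree posnat) : seq (seq nat * posnat) :=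
  if t is Node n ts
  then ([::], n) ::
       flatten [seq [seq (p.1 :: v.1, v.2) | v <- p.2]
               | p <- zip (iota 0 (size ts)) (map vertices ts)]
  else [::].

Definition nu (t : vtree) : finType := seq_sub (vertices (val t)).

Definition strict_ancestor (t : vtree) (w v : nu t) : bool :=
  prefix (val w).1 (val v).1 && (w != v).

Definition tree_dom (t : vtree) : set {ffun nu t -> posnat} :=
  [set k | forall v w, strict_ancestor w v -> (val (k v) < val (k w))%N].
#[global] Arguments tree_dom t : clear implicits.

Definition tree_term (t : vtree) (k : {ffun nu t -> posnat}) : R :=
  \prod_(v : nu t) ((val (k v))%:R ^+ val (val v).2)^-1.

Definition zetaT_tree (t : vtree) : R :=
  fine (\esum_(k in tree_dom t) (tree_term k)%:E).

Definition zetaT : Tree R -> R := lin_ext (V := R^o) zetaT_tree.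

End Tree.

Arguments Words_conv R : clear implicits.
Arguments S_conv R : clear implicits.
Arguments Tridend_conv R : clear implicits.
Arguments Tree_conv R : clear implicits.
Arguments fseries_prod R w n : clear implicits.
Arguments tree_term R t k : clear implicits.
Arguments zetaFS R _ : clear implicits.
Arguments zeta R _ : clear implicits.
Arguments ev R x : clear implicits.
Arguments Psi R _ : clear implicits.
Arguments zetaTri R _ : clear implicits.
Arguments iota_map R _ : clear implicits.
Arguments flat R _ : clear implicits.
Arguments zetaT R _ : clear implicits.

(* Main.v *)
Require Import Defs.
From HB Require Import structures.
From mathcomp Require Import all_boot all_order all_algebra.
From mathcomp Require Import finmap boolp classical_sets functions reals ereal esum.
From mathcomp Require Import topology normedtype sequences cardinality fsbigop.
From mathcomp Require Import ring lra.
From mathcomp Require Import -(notations) monalg.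

(* The span of the fs_gen w is free on the words: A |-> [0 \notin A] kills the
   modular ideal and sends every region of summation to 1.  On both sides the three
   products are sums over quasi-shuffles, and such sums obey the recursion that
   defines qshuffle; hence zetaFS is a morphism of tridendriform algebras.  Along
   its right or left branch a tree is a ladder on which forests are grafted, so that
   flat \o iota sends it to a nested expression p_1 (x_1 * p_2 (x_2 * ...)) in the
   commutative algebra of words, and the same recursion makes flat \o iota a
   morphism.  A morphism on trees is determined by the Y_n because
   Node (w a) (ts s) = Node w ts . (Y_a < s) and Node a (t, s) = t > (Y_a < s).

   For the sums, truncate: the multiple zeta values restricted to n_1 <= N turn the
   quasi-shuffle into the product of real numbers, so the truncated sum over a tree
   equals the truncated zeta value of its flattening, and N goes to infinity.
   Convergence comes from \sum_(m > n) m^-2 <= 1/n, which bounds the value of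
   a b w, for a >= 2, by that of (b + 1) w. *)

Set Implicit Arguments.
Unset Strict Implicit.
Unset Printing Implicit Defensive.
Import Order.TTheory GRing.Theory Num.Theory.
Import numFieldNormedType.Exports.

Local Open Scope classical_set_scope.

(** * Linear and bilinear extensions *)

Section LinExt.
Local Open Scope ring_scope.
Variable R : realType.
Implicit Types K : choiceType.

(** Three obstacles shape the proof. A quasi-shuffle is a finite function whose codomain depends on
    the number of its fibers, a form that no induction on words respects. The list of its fibers
    does respect it, and a single identity on such lists ([sum_qs]) then covers both words, whose
    letters carry the unit, and trees, whose letters carry forests. The products of formal series
    are computed from coordinates chosen classically, so they are out of reach until the family
    [fs_gen] is known to be free. Finally, convergence constrains only the root of a tree: the
    flattenings of its subtrees may diverge, so the product formula cannot be applied to their zeta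
    values. Truncation at N is finite and multiplicative on all words, and the limit is taken only
    once, at the root. *)

Lemma lin_extEw K (V : lmodType R) (f : K -> V) (x : malg K R) (d : {fset K}) :
  fsubset (msupp x) d -> lin_ext f x = \sum_(k <- d) mcoeff k x *: f k.
Proof.
move=> hd; rewrite /lin_ext (big_fset_incl _ hd) //= => k _ hk.
by rewrite mcoeff_outdom // scale0r.
Qed.

Fact lin_ext_is_linear K (V : lmodType R) (f : K -> V) : linear (lin_ext f).
Proof.
move=> a x y; pose d := fsetU (msupp x) (msupp y).
rewrite (@lin_extEw _ _ _ (a *: x + y) d); last first.
  apply: fsubset_trans (msuppD_le _ _) _.
  by apply: fsetUSS => //; apply: msuppZ_le.
rewrite (@lin_extEw _ _ _ x d) ?fsubsetUl // (@lin_extEw _ _ _ y d) ?fsubsetUr //.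
rewrite scaler_sumr -big_split /=; apply: eq_bigr => k _.
by rewrite mcoeffD mcoeffZ scalerDl scalerA.
Qed.

HB.instance Definition _ K (V : lmodType R) (f : K -> V) :=
  GRing.isLinear.Build R (malg K R) V *:%R (lin_ext f) (lin_ext_is_linear f).

Lemma lin_ext_bas K (V : lmodType R) (f : K -> V) k : lin_ext f (bas R k) = f k.
Proof.
by rewrite /lin_ext /bas msuppU oner_eq0 big_seq_fset1 mcoeffUU scale1r.
Qed.

Lemma lin_ext_id K (x : malg K R) : lin_ext (bas R) x = x.
Proof.
rewrite [RHS]monalgE; apply: eq_bigr => k _.
by apply/malgP => k'; rewrite mcoeffZ !mcoeffU mulr_natr.
Qed.

Lemma eq_lin_ext K (V : lmodType R) (f g : K -> V) : f =1 g -> lin_ext f =1 lin_ext g.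
Proof. by move=> h x; apply: eq_bigr => k _; rewrite h. Qed.

Lemma linear_lin_ext K (V W : lmodType R) (f : {linear V -> W}) (g : K -> V) x :
  f (lin_ext g x) = lin_ext (f \o g) x.
Proof. by rewrite /lin_ext linear_sum; apply: eq_bigr => k _; rewrite linearZ. Qed.

Lemma malg_lin_ext K (W : lmodType R) (f : {linear malg K R -> W}) x :
  f x = lin_ext (fun k => f (bas R k)) x.
Proof. by rewrite -[x in LHS]lin_ext_id linear_lin_ext. Qed.

Lemma malg_ind K (P : malg K R -> Prop) :
  P 0 -> (forall k, P (bas R k)) -> (forall a x y, P x -> P y -> P (a *: x + y)) ->
  forall x, P x.
Proof.
move=> P0 Pb PD x; rewrite -[x]lin_ext_id /lin_ext.
elim/big_ind: _ => // [u v hu hv|k _]; first by rewrite -[u]scale1r; apply: PD.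
by rewrite -[_ *: _]addr0; apply: PD.
Qed.

Lemma subspace_lin_ext K (V : lmodType R) (U : set V) (f : K -> V) x :
  Defs.subspace U -> (forall k, k \in msupp x -> U (f k)) -> U (lin_ext f x).
Proof.
move=> [U0 UD] h; rewrite /lin_ext big_seq_cond; elim/big_ind: _ => //.
- by move=> u v hu hv; rewrite -[u]scale1r; apply: UD.
- by move=> k /andP[/h hk _]; rewrite -[_ *: _]addr0; apply: UD.
Qed.

Lemma lspan_gen (V : lmodType R) (X : set V) x : X x -> lspan X x.
Proof. by move=> Xx U [_]; apply. Qed.

Lemma lspan_min (V : lmodType R) (X U : set V) :
  Defs.subspace U -> X `<=` U -> lspan X `<=` U.
Proof. by move=> hU hX x; apply. Qed.

Lemma lspan_basP K (P : pred K) (x : malg K R) :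
  lspan [set bas R k | k in [set k | P k]] x <-> {subset msupp x <= P}.
Proof.
split=> [hx|h].
  apply: (@lspan_min _ _ [set x | {subset msupp x <= P}] _ _ x hx).
    split=> [k|a u v hu hv k]; first by rewrite msupp0 in_fset0.
    move=> /(fsubsetP (msuppD_le _ _)); rewrite in_fsetU => /orP[|/hv //].
    by move=> /(fsubsetP (msuppZ_le _ _)) /hu.
  by move=> _ [k hk <-] k'; rewrite /bas msuppU oner_eq0 in_fset1 => /eqP ->.
rewrite -[x]lin_ext_id; apply: subspace_lin_ext; first exact: lspan_subspace.
by move=> k /h hk; apply: lspan_gen; exists k.
Qed.

Section Independent.
Variables (K : choiceType) (V : lmodType R) (b : K -> V).
Hypothesis b_inj : injective (lin_ext b).

Lemma coords_lin_ext c : coords b (lin_ext b c) = c.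
Proof.
apply: b_inj; rewrite /coords; case: xgetP => [d _ //|h].
by case: (h c).
Qed.

Lemma bilin_ext_lin_ext (f : K -> K -> V) x y :
  bilin_ext b f (lin_ext b x) (lin_ext b y) = lin_ext (fun u => lin_ext (f u) y) x.
Proof. by rewrite /bilin_ext !coords_lin_ext. Qed.

End Independent.

Lemma bas_inj K : injective (lin_ext (@bas R K)).
Proof. by move=> x y; rewrite !lin_ext_id. Qed.

Lemma bilin_ext_bas K (f : K -> K -> malg K R) x y :
  bilin_ext (@bas R K) f x y = lin_ext (fun u => lin_ext (f u) y) x.
Proof.
by rewrite -{1}[x]lin_ext_id -{1}[y]lin_ext_id bilin_ext_lin_ext //; apply: bas_inj.
Qed.

(** The double extension of [bilin_ext], but on free modules, possibly over two different bases, so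
    that no coordinates have to be chosen. *)
Definition bilin (K K' : choiceType) (V : lmodType R) (f : K -> K' -> V) x y : V :=
  lin_ext (fun u => lin_ext (f u) y) x.

Lemma bilin_bas K K' (V : lmodType R) (f : K -> K' -> V) u v :
  bilin f (bas R u) (bas R v) = f u v.
Proof. by rewrite /bilin !lin_ext_bas. Qed.

Fact bilin_is_linear_r K K' (V : lmodType R) (f : K -> K' -> V) x : linear (bilin f x).
Proof.
move=> a y z; rewrite /bilin /lin_ext scaler_sumr -big_split /=.
apply: eq_bigr => k _.
have /= := lin_ext_is_linear (f k) a y z; rewrite /lin_ext => ->.
by rewrite scalerDr !scalerA mulrC.
Qed.

HB.instance Definition _ K K' (V : lmodType R) (f : K -> K' -> V) x :=
  GRing.isLinear.Build R (malg K' R) V *:%R (bilin f x) (bilin_is_linear_r f x).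

Lemma bilinP K K' (V : lmodType R) (f : K -> K' -> V) y : linear (bilin f ^~ y).
Proof. by move=> a x z; rewrite /bilin linearP. Qed.

Lemma bilin_lin_ext (I J : choiceType) K K' (V : lmodType R) (f : K -> K' -> V)
    (c : I -> malg K R) (c' : J -> malg K' R) x y :
  bilin f (lin_ext c x) (lin_ext c' y) = bilin (fun u v => bilin f (c u) (c' v)) x y.
Proof.
rewrite {1}/bilin linear_lin_ext; apply: eq_lin_ext => u; rewrite [LHS]/=.
by rewrite [LHS](linear_lin_ext (bilin f (c u))).
Qed.

Lemma linear_bilin K K' (V W : lmodType R) (g : {linear V -> W})
    (f : K -> K' -> V) x y :
  g (bilin f x y) = bilin (fun u v => g (f u v)) x y.
Proof.
by rewrite linear_lin_ext; apply: eq_lin_ext => u /=; rewrite linear_lin_ext.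
Qed.

Lemma eq_in_bilin K K' (V : lmodType R) (f g : K -> K' -> V) x y :
  (forall u v, u \in msupp x -> v \in msupp y -> f u v = g u v) ->
  bilin f x y = bilin g x y.
Proof.
move=> h; rewrite /bilin /lin_ext big_seq_cond [RHS]big_seq_cond.
apply: eq_bigr => u /andP[hu _]; congr (_ *: _).
rewrite big_seq_cond [RHS]big_seq_cond.
by apply: eq_bigr => v /andP[hv _]; rewrite h.
Qed.

(** A morphism can be tested on basis elements, [c k] being the coordinates along [b] of the image
    of [bas R k]. The support condition keeps the images of non-unit elements in the augmentation
    part, so that the conventions of [tridend_on] about the unit never intervene. *)
Lemma tridend_on_morphism (K K' : choiceType) (W : lmodType R) (b : K' -> W)
    e e' p s d p' s' d' (f : {linear malg K R -> W}) (c : K -> malg K' R) :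
  injective (lin_ext b) ->
  (forall k, f (bas R k) = lin_ext b (c k)) -> c e = bas R e' ->
  (forall k, k != e -> e' \notin msupp (c k)) ->
  (forall k l, k != e -> l != e ->
     [/\ f (p k l) = bilin p' (c k) (c l), f (s k l) = bilin s' (c k) (c l)
       & f (d k l) = bilin d' (c k) (c l)]) ->
  tridend_morphism (A := tridend_on (@bas R K) e p s d)
                   (B := tridend_on b e' p' s' d') f.
Proof.
move=> b_inj fc ce supp_c h.
have fE x : f x = lin_ext b (lin_ext c x).
  by rewrite [LHS]malg_lin_ext linear_lin_ext; apply: eq_lin_ext => k; rewrite fc.
have supp x : lspan [set bas R k | k in [set k | k != e]] x ->
    {subset msupp x <= predC1 e} by move/lspan_basP.
(* [r] and [r'] stand for the tables of [tridend_on], [q] and [q'] for the bare products; one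
   statement serves the three operations. *)
have prod q q' r r' x y :
    (forall k l, k != e -> l != e ->
       [/\ r k l = q k l, f (q k l) = bilin q' (c k) (c l)
         & forall k' l', k' != e' -> l' != e' -> r' k' l' = q' k' l']) ->
    lspan [set bas R k | k in [set k | k != e]] x ->
    lspan [set bas R k | k in [set k | k != e]] y ->
    f (bilin_ext (@bas R K) r x y) = bilin_ext b r' (f x) (f y).
  move=> hq /supp hx /supp hy; rewrite !fE bilin_ext_lin_ext // bilin_ext_bas.
  rewrite -fE -/(bilin _ _ _) -/(bilin _ _ _) bilin_lin_ext linear_bilin.
  apply: eq_in_bilin => u v /hx hu /hy hv; have [-> -> h'] := hq _ _ hu hv.
  apply: eq_in_bilin => u' v' hu' hv'.
  by rewrite h' //; [apply: contraNneq (supp_c _ hu)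
                    | apply: contraNneq (supp_c _ hv)] => <-.
split.
- exact: linearP.
- by rewrite /= fc ce lin_ext_bas.
- move=> x /supp hx; rewrite /= fE [lin_ext c x]/lin_ext linear_sum /=.
  rewrite big_seq_cond; elim/big_ind: _.
  + by case: (lspan_subspace [set b k | k in [set k | k != e']]).
  + move=> u v hu hv; rewrite -[u]scale1r.
    by case: (lspan_subspace [set b k | k in [set k | k != e']]) => _; apply.
  + move=> k /andP[/hx hk _]; rewrite linearZ /=.
    have [h0 hD] := lspan_subspace [set b k | k in [set k | k != e']].
    rewrite -[_ *: _]addr0; apply: (hD) => //; apply: subspace_lin_ext => // l hl.
    by apply: lspan_gen; exists l => //=; apply: contraNneq (supp_c _ hk) => <-.
- move=> x y hx hy; apply: (prod p p') => // k l hk hl; split.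
  + by rewrite (negPf hk) (negPf hl).
  + by case: (h _ _ hk hl).
  + by move=> k' l' hk' hl'; rewrite (negPf hk') (negPf hl').
- move=> x y hx hy; apply: (prod s s') => // k l hk hl; split.
  + by rewrite (negPf hk) (negPf hl).
  + by case: (h _ _ hk hl).
  + by move=> k' l' hk' hl'; rewrite (negPf hk') (negPf hl').
- move=> x y hx hy; apply: (prod d d') => // k l hk hl; split.
  + by rewrite (negPf hk) (negPf hl).
  + by case: (h _ _ hk hl).
  + by move=> k' l' hk' hl'; rewrite (negPf hk') (negPf hl').
Qed.

End LinExt.

(** * Quasi-shuffles as sequences of fibers *)

Section QuasiShuffleLists.

(* A quasi-shuffle of the words u and v is encoded by the sequence of its fibers,
   each of which consists of a letter of u, a letter of v, or both. *)
Fixpoint qs (T : Type) (u : seq T) : seq T -> seq (seq (seq T)) :=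
  fix aux (v : seq T) :=
    match u, v with
    | [::], _ => [:: [seq [:: y] | y <- v]]
    | _, [::] => [:: [seq [:: x] | x <- u]]
    | a :: u', b :: v' =>
        map (cons [:: a]) (qs u' v) ++ map (cons [:: b]) (aux v')
        ++ map (cons [:: a; b]) (qs u' v')
    end.

Lemma qs0l T (v : seq T) : qs [::] v = [:: [seq [:: y] | y <- v]].
Proof. by case: v. Qed.

Lemma qs0r T (u : seq T) : qs u [::] = [:: [seq [:: x] | x <- u]].
Proof. by case: u. Qed.

Lemma qs_cons T a b (u v : seq T) :
  qs (a :: u) (b :: v) = map (cons [:: a]) (qs u (b :: v))
    ++ map (cons [:: b]) (qs (a :: u) v) ++ map (cons [:: a; b]) (qs u v).
Proof. by []. Qed.

Lemma qs_map T T' (f : T -> T') u v :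
  qs (map f u) (map f v) = map (map (map f)) (qs u v).
Proof.
elim: u v => [|a u IHu] v; first by rewrite !qs0l /= -!map_comp.
elim: v => [|b v IHv]; first by rewrite !qs0r /= -!map_comp.
rewrite !map_cons [LHS]qs_cons qs_cons !map_cat -!map_comp.
rewrite -[f b :: map f v]map_cons -[f a :: map f u]map_cons.
by rewrite !IHu IHv -!map_comp.
Qed.

Section Eq.
Variable T : eqType.
Implicit Types (u v : seq T) (s : T -> nat).

(** The first fibers [[:: a]], [[:: b]] and [[:: a; b]] tell the three branches of the recursion
    apart as soon as a and b differ. *)
Lemma uniq_qs u v : uniq (u ++ v) -> uniq (qs u v).
Proof.
elim: u v => [|a u IHu] v; first by rewrite qs0l.
elim: v => [|b v IHv] huv; first by rewrite qs0r.
have neq_ab : a != b.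
  by move: huv => /=; rewrite mem_cat inE negb_or negb_or => /andP[/and3P[]].
have hav : uniq ((a :: u) ++ v).
  by apply: subseq_uniq huv; rewrite cat_subseq // subseq_cons.
have cons_inj (x : seq T) : injective (cons x) by move=> ? ? [].
rewrite qs_cons !cat_uniq !map_inj_uniq // IHv // !IHu /=; last first.
- by case/andP: huv.
- by case/andP: hav.
rewrite !andbT; apply/andP; split; apply/hasPn => L.
  rewrite mem_cat => /orP[] /mapP[L' _ ->]; apply/negP => /mapP[L'' _] [] // /eqP.
  by rewrite eq_sym (negPf neq_ab).
by move=> /mapP[L' _ ->]; apply/negP => /mapP[L'' _].
Qed.

Lemma size_qs u v L : L \in qs u v -> (size L <= size u + size v)%N.
Proof.
elim: u v L => [|a u IHu] v L; first by rewrite qs0l inE => /eqP ->; rewrite size_map.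
elim: v L => [|b v IHv] L; first by rewrite qs0r inE => /eqP ->; rewrite size_map addn0.
rewrite qs_cons !mem_cat => /or3P[] /mapP[L' hL' ->] /=.
- by rewrite addSn ltnS; apply: IHu hL'.
- by rewrite addnS ltnS; apply: IHv.
- by rewrite addSn ltnS (leq_trans (IHu _ _ hL')) // leq_add2l.
Qed.

Definition fib s u v j := [seq x <- u | s x == j] ++ [seq x <- v | s x == j].

(** The quasi-shuffle conditions for a map on arbitrary words, with image the interval [m, m + n).
    The offset m makes the notion stable under removal of the lowest fiber, on which the induction
    runs. *)
Definition qsh_on s u v m n :=
  [&& sorted (relpre s ltn) u, sorted (relpre s ltn) v,
      all (fun x => m <= s x < m + n)%N (u ++ v)
    & all (fun j => has (fun x => s x == j) (u ++ v)) (iota m n)].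

Lemma sorted_behead s a u m : sorted (relpre s ltn) (a :: u) -> (m <= s a)%N ->
  all (fun x => m < s x)%N u.
Proof.
move=> hp hm; have tr : transitive (relpre s ltn) by move=> y x z; apply: ltn_trans.
by apply: sub_all (order_path_min tr hp) => x /=; apply: leq_ltn_trans.
Qed.

Lemma filter_gt s u m : all (fun x => m < s x)%N u -> [seq x <- u | s x == m] = [::].
Proof.
move=> /allP h; apply/eqP; rewrite -[_ == _]negbK -has_filter; apply/hasPn => x /h.
by rewrite ltn_neqAle eq_sym => /andP[].
Qed.

(** By strict monotonicity the lowest fiber contains at most the first letter of u and the first
    letter of v; removing it leaves a quasi-shuffle with values from m + 1 on. *)
Lemma fib_qs s u v m n :
  qsh_on s u v m n -> [seq fib s u v j | j <- iota m n] \in qs u v.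
Proof.
elim: n m u v => [|n IH] m u v.
  move=> /and4P[_ _ h _]; suff : u ++ v = [::] by case: u {h} => // /= ->.
  case: (u ++ v) h => //= x w /andP[/andP[h1 h2] _].
  by have := leq_ltn_trans h1 h2; rewrite addn0 ltnn.
have split w : sorted (relpre s ltn) w -> all (fun x => m <= s x < m + n.+1)%N w ->
    exists h w', [/\ w = h ++ w', h = [seq x <- w | s x == m], (size h <= 1)%N,
      sorted (relpre s ltn) w' & all (fun x => m.+1 <= s x < m.+1 + n)%N w'].
  case: w => [|a w] hs hm; first by exists [::], [::].
  have [/andP[ha ha'] hw] := andP hm.
  have hw' := sorted_behead hs ha.
  have hr : all (fun x => m.+1 <= s x < m.+1 + n)%N w.
    apply/allP => x hx; rewrite (allP hw' x hx) addSnnS.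
    by have /andP[] := allP hw x hx.
  move: ha; rewrite leq_eqVlt => /predU1P[ha|ha].
    have e : [seq x <- a :: w | s x == m] = [:: a] by rewrite /= -ha eqxx filter_gt.
    by exists [:: a], w; rewrite e; split => //; apply: path_sorted hs.
  have e : [seq x <- a :: w | s x == m] = [::] by rewrite /= gtn_eqF // filter_gt.
  exists [::], (a :: w); rewrite e; split => //.
  by apply/andP; split => //; rewrite ha addSnnS.
move=> /and4P[su sv]; rewrite all_cat => /andP[au av] hm.
have [h [u' [eu hh sh su' au']]] := split _ su au.
have [k [v' [ev hk sk sv' av']]] := split _ sv av.
(* The removed letters all have value m, so the other fibers are unchanged. *)
have filt w w' h' : w = h' ++ w' -> h' = [seq x <- w | s x == m] ->
    forall j, j != m -> [seq x <- w | s x == j] = [seq x <- w' | s x == j].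
  move=> -> e j hj; rewrite filter_cat.
  suff -> : [seq x <- h' | s x == j] = [::] by [].
  apply/eqP; rewrite -[_ == _]negbK -has_filter; apply/hasPn => x; rewrite e mem_filter.
  by move=> /andP[/eqP -> _]; rewrite eq_sym.
have IHn : [seq fib s u v j | j <- iota m.+1 n] \in qs u' v'.
  have -> : [seq fib s u v j | j <- iota m.+1 n]
      = [seq fib s u' v' j | j <- iota m.+1 n].
    apply/eq_in_map => j; rewrite mem_iota => /andP[hj _].
    by rewrite /fib (filt _ _ _ eu hh) ?(filt _ _ _ ev hk) // gtn_eqF.
  apply: IH; apply/and4P; split => //; first by rewrite all_cat au' av'.
  apply/allP => j hj; have /hasP[x hx sx] : has (fun x => s x == j) (u ++ v).
    by apply: (allP hm); rewrite /= inE hj orbT.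
  have hjm : j != m by move: hj; rewrite mem_iota => /andP[/gtn_eqF ->].
  apply/hasP; exists x => //; move: hx; rewrite !mem_cat.
  suff sub w w' h' : w = h' ++ w' -> h' = [seq x <- w | s x == m] ->
      x \in w -> x \in w'.
    by move=> /orP[/(sub _ _ _ eu hh) ->|/(sub _ _ _ ev hk) ->]; rewrite ?orbT.
  move=> ew e hx; have : x \in [seq x <- w | s x == j] by rewrite mem_filter sx.
  by rewrite (filt _ _ _ ew e) // mem_filter => /andP[].
(* Surjectivity excludes an empty lowest fiber; the three remaining shapes are those of the
   recursion of [qs]. *)
have hhk : (0 < size (h ++ k))%N.
  have /hasP[x hx sx] : has (fun x => s x == m) (u ++ v).
    by apply: (allP hm); rewrite /= inE eqxx.
  have : x \in h ++ k by rewrite hh hk -filter_cat mem_filter sx.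
  by case: (h ++ k).
rewrite [map _ _]/= {1}/fib -hh -hk.
set M := map _ _ in IHn *; clearbody M; rewrite eu ev.
case: h k sh sk hhk {hh hk} eu ev => [|a [|? ?]] // [|b [|? ?]] // _ _ _ _ _;
  rewrite ?cat0s ?cat1s.
- case: u' IHn {su' au'} => [|a u'] hn.
    by move: hn; rewrite !qs0l !inE => /eqP ->.
  by rewrite qs_cons !mem_cat (map_f (cons [:: b]) hn) orbT.
- case: v' IHn {sv' av'} => [|b v'] hn.
    by move: hn; rewrite !qs0r !inE => /eqP ->.
  by rewrite qs_cons !mem_cat (map_f (cons [:: a]) hn).
- by rewrite qs_cons !mem_cat (map_f (cons [:: a; b]) IHn) !orbT.
Qed.

(** Inverts one step of [qs] uniformly, including the cases where one word is empty: the first fiber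
    is made of at most one letter from the front of each word. *)
Lemma qs_inv u v x L : x :: L \in qs u v ->
  exists h u' k v', [/\ u = h ++ u', v = k ++ v', x = h ++ k,
    [&& (size h <= 1)%N, (size k <= 1)%N & (0 < size x)%N] & L \in qs u' v'].
Proof.
case: u v => [|a u] [|b v].
- by rewrite inE.
- rewrite qs0l inE /= => /eqP[-> ->]; exists [::], [::], [:: b], v.
  by split=> //; rewrite qs0l inE.
- rewrite qs0r inE /= => /eqP[-> ->]; exists [:: a], u, [::], [::].
  by split=> //; rewrite qs0r inE.
rewrite qs_cons !mem_cat => /or3P[] /mapP[L' hL [-> ->]].
- by exists [:: a], u, [::], (b :: v).
- by exists [::], (a :: u), [:: b], v.
- by exists [:: a], u, [:: b], v.
Qed.

Lemma qs_nil_inv u v : [::] \in qs u v -> u = [::] /\ v = [::].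
Proof.
case: u v => [|a u] [|b v]; rewrite ?qs_cons ?mem_cat ?qs0l ?qs0r ?inE //.
by move=> /or3P[] /mapP[].
Qed.

(** Converse of [fib_qs]. Distinct letters are what allows a map to be recovered from its fibers. *)
Lemma qs_fib u v L : uniq (u ++ v) -> L \in qs u v ->
  exists2 s, qsh_on s u v 0 (size L) & L = [seq fib s u v j | j <- iota 0 (size L)].
Proof.
elim: L u v => [|x L IH] u v huv.
  by move=> /qs_nil_inv[-> ->]; exists (fun=> 0%N).
move=> /qs_inv[h [u' [k [v' [eu ev ex /and3P[sh sk sx] hL]]]]].
move: huv; rewrite eu ev (perm_uniq (permEl (perm_catACA _ _ _ _))) -ex cat_uniq.
rewrite has_cat negb_or => /and3P[_ /andP[hu hv] huv].
have [s /and4P[su sv sm sj] ->] := IH _ _ huv hL; rewrite [size _]/= size_map size_iota.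
(* The first fiber gets value 0, and the map given by induction on the remaining letters is shifted
   by one. *)
pose t y := if y \in x then 0%N else (s y).+1.
have tx y : y \in x -> t y = 0%N by rewrite /t => ->.
have tn w y : ~~ has (mem x) w -> y \in w -> t y = (s y).+1.
  by move=> /hasPn hw /hw; rewrite /t /= => /negPf ->.
have hx : {subset h <= x} by move=> y; rewrite ex mem_cat => ->.
have kx : {subset k <= x} by move=> y; rewrite ex mem_cat orbC => ->.
have sorted_t g w : {subset g <= x} -> (size g <= 1)%N -> ~~ has (mem x) w ->
    sorted (relpre s ltn) w -> sorted (relpre t ltn) (g ++ w).
  move=> gx sg hw; rewrite -!sorted_map map_cat.
  have -> : map t w = map S (map s w).
    by rewrite -map_comp; apply/eq_in_map => y; apply: tn.
  case: g gx sg => [|a [|//]] gx _ hs /=; first by rewrite (@mono_sorted _ _ S ltn ltn).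
  rewrite tx ?gx ?inE // path_sortedE; last exact: ltn_trans.
  by rewrite (@mono_sorted _ _ S ltn ltn) // hs andbT; apply/allP => _ /mapP[y _ ->].
have filt0 g w : {subset g <= x} -> ~~ has (mem x) w ->
    [seq y <- g ++ w | t y == 0%N] = g.
  move=> gx hw; rewrite filter_cat (_ : [seq y <- w | _] = [::]) ?cats0.
    by apply/all_filterP/allP => y /gx /tx ->.
  apply/eqP; rewrite -[_ == _]negbK -has_filter; apply/hasPn => y hy.
  by rewrite (tn _ _ hw hy).
have filtS g w j : {subset g <= x} -> ~~ has (mem x) w ->
    [seq y <- g ++ w | t y == j.+1] = [seq y <- w | s y == j].
  move=> gx hw; rewrite filter_cat (_ : [seq y <- g | _] = [::]) ?cat0s.
    by apply: eq_in_filter => y hy; rewrite (tn _ _ hw hy) eqSS.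
  apply/eqP; rewrite -[_ == _]negbK -has_filter; apply/hasPn => y hy.
  by rewrite tx ?gx.
exists t.
  have mem_xt : x ++ (u' ++ v') =i (h ++ u') ++ (k ++ v').
    by move=> y; rewrite ex !mem_cat; do !case: (_ \in _).
  rewrite /qsh_on !sorted_t //=; apply/and3P; split.
  - rewrite -(eq_all_r mem_xt) all_cat; apply/andP; split.
      by apply/allP => y /tx ->.
    apply/allP => y hy; have := allP sm _ hy; rewrite !add0n.
    suff -> : t y = (s y).+1 by [].
    by move: hy; rewrite mem_cat => /orP[]; apply: tn.
  - rewrite -(eq_has_r mem_xt) has_cat; apply/orP; left; apply/hasP.
    case: (x) sx tx => // y x' _ /(_ y); rewrite inE eqxx => /(_ isT) h0.
    by exists y; rewrite ?inE ?eqxx // h0.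
  - apply/allP => j; rewrite -[1%N]addn0 iotaDl.
    move=> /mapP[i /(allP sj) /hasP[y hy /eqP <-] ->].
    rewrite -(eq_has_r mem_xt) has_cat; apply/orP; right; apply/hasP; exists y => //.
    by apply/eqP; rewrite add1n; move: hy; rewrite mem_cat => /orP[]; apply: tn.
rewrite [iota 0 _.+1]/= -[1%N]addn0 iotaDl map_cons -map_comp.
congr (_ :: _); first by rewrite /fib !filt0.
by apply: eq_map => j /=; rewrite /fib add1n !filtS.
Qed.

End Eq.

Section Fibers.
Variables k l : nat.

Lemma cat_iota : iota 0 k ++ iota k l = iota 0 (k + l).
Proof. by rewrite iotaD. Qed.

Definition fibers n (q : Qsh k l n) : seq (seq nat) := [seq fiber q m | m <- enum 'I_n].

(** Extends q to all integers, so that [iota] can replace ordinals; the default value 0 is only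
    taken from k + l on. *)
Definition qsh_fun n (q : Qsh k l n) (i : nat) : nat :=
  oapp (fun j : 'I_(k + l) => val (val q j)) 0%N (insub i).

Lemma qsh_funE n (q : Qsh k l n) (i : 'I_(k + l)) : qsh_fun q i = val q i.
Proof. by rewrite /qsh_fun valK. Qed.

Lemma fibersE n (q : Qsh k l n) :
  fibers q = [seq fib (qsh_fun q) (iota 0 k) (iota k l) j | j <- iota 0 n].
Proof.
rewrite /fibers -(val_enum_ord n) -[RHS]map_comp; apply: eq_map => m /=.
rewrite /fib -filter_cat cat_iota /fiber -(val_enum_ord (k + l)) [RHS]filter_map.
by congr (map _ _); apply: eq_filter => i /=; rewrite qsh_funE.
Qed.

Lemma size_fibers n (q : Qsh k l n) : size (fibers q) = n.
Proof. by rewrite size_map size_enum_ord. Qed.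

Lemma fibers_inj n : injective (@fibers n).
Proof.
move=> p q h; apply/val_inj/ffunP => i; apply/val_inj.
have : fiber p (val p i) = fiber q (val p i).
  have /(congr1 (fun L => nth [::] L (val p i))) := h.
  rewrite /fibers [LHS](nth_map (val p i)) ?size_enum_ord //.
  rewrite [RHS](nth_map (val p i)) ?size_enum_ord //.
  by rewrite !nth_ord_enum.
have : val i \in fiber p (val p i) by apply: map_f; rewrite mem_filter eqxx mem_enum.
move=> /[swap] ->; rewrite mem_map; last exact: val_inj.
by rewrite mem_filter => /andP[/eqP ->].
Qed.

Lemma sorted_iota s m n : (forall i j, m <= i -> i < j -> j < m + n -> s i < s j)%N ->
  sorted (relpre s ltn) (iota m n).
Proof.
elim: n m => // n IH m h /=; have : sorted (relpre s ltn) (iota m.+1 n).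
  by apply: IH => i j hi hij hj; apply: h => //; [apply: ltnW | rewrite addnS -addSn].
case: n {IH} h => //= n h ->; by rewrite h // !addnS !ltnS leq_addr.
Qed.

Lemma qsh_fun_on n (q : Qsh k l n) : qsh_on (qsh_fun q) (iota 0 k) (iota k l) 0 n.
Proof.
have /and3P[/forallP hl /forallP hr /forallP hs] := valP q.
rewrite /qsh_on cat_iota; apply/and4P; split.
- apply: sorted_iota => i j _ hij hj.
  have hi := ltn_trans hij hj.
  have /forallP /(_ (Ordinal hj)) /implyP /(_ hij) := hl (Ordinal hi).
  by rewrite -!qsh_funE.
- apply: sorted_iota => i j hk hij hj.
  have hi := ltn_trans hij hj.
  have hi' : (i - k < l)%N by rewrite ltn_subLR.
  have hj' : (j - k < l)%N by rewrite ltn_subLR // (leq_trans hk (ltnW hij)).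
  have hij' : (i - k < j - k)%N by rewrite ltn_sub2r // (leq_ltn_trans hk).
  have /forallP /(_ (Ordinal hj')) /implyP /(_ hij') := hr (Ordinal hi').
  by rewrite -!qsh_funE /= !subnKC // (leq_trans hk (ltnW hij)).
- apply/allP => i; rewrite mem_iota => /andP[_ hi].
  by rewrite -[i]/(val (Ordinal hi)) qsh_funE /= ltn_ord.
- apply/allP => j; rewrite mem_iota => /andP[_ hj].
  have /existsP[i /eqP hi] := hs (Ordinal hj).
  by apply/hasP; exists (val i); rewrite ?mem_iota //= qsh_funE hi.
Qed.

Lemma fibers_surj L : L \in qs (iota 0 k) (iota k l) ->
  exists q : Qsh k l (size L), fibers q = L.
Proof.
move=> hL; have [|s /and4P[su sv]] := qs_fib _ hL.
  by rewrite cat_iota iota_uniq.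
rewrite cat_iota => sm sj eL.
have sn (i : 'I_(k + l)) : (s i < size L)%N.
  by have := allP sm i; rewrite mem_iota /= => /(_ (ltn_ord i)).
have mono m n i j : sorted (relpre s ltn) (iota m n) -> (m <= i)%N -> (i < j)%N ->
    (j < m + n)%N -> (s i < s j)%N.
  move=> hs hi hij hj.
  have tr : transitive (relpre s ltn) by move=> y x z; apply: ltn_trans.
  have /(_ (i - m) (j - m))%N := sorted_ltn_nth tr 0%N hs.
  have hmj : (m <= j)%N by rewrite (leq_trans hi (ltnW hij)).
  have hi' : (i - m < n)%N by rewrite ltn_subLR // (ltn_trans hij).
  have hj' : (j - m < n)%N by rewrite ltn_subLR.
  rewrite !inE size_iota !nth_iota //= !subnKC //.
  by apply => //; rewrite ltn_sub2r // (leq_ltn_trans hi).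
pose q := [ffun i : 'I_(k + l) => Ordinal (sn i)].
have hq : is_qsh q.
  apply/and3P; split.
  - apply/forallP => i; apply/forallP => j; apply/implyP => hij; rewrite !ffunE /=.
    by apply: (mono _ _ _ _ su).
  - apply/forallP => i; apply/forallP => j; apply/implyP => hij; rewrite !ffunE /=.
    by apply: (mono _ _ _ _ sv) => //; rewrite ?leq_addr ?ltn_add2l.
  - apply/forallP => m; apply/existsP.
    have /hasP[i hi /eqP hm] := allP sj m (ltac:(by rewrite mem_iota /= ltn_ord)).
    rewrite mem_iota /= in hi; exists (Ordinal hi).
    by rewrite ffunE; apply/eqP/val_inj.
exists (Sub q hq); rewrite fibersE [RHS]eL; apply: eq_map => j.
have e i : i \in iota 0 (k + l) -> qsh_fun (Sub q hq : Qsh k l _) i = s i.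
  rewrite mem_iota /= => hi; rewrite -[i]/(val (Ordinal hi)) qsh_funE.
  by rewrite SubK ffunE.
by rewrite /fib; congr (_ ++ _); apply: eq_in_filter => i hi; rewrite e //;
   rewrite iotaD mem_cat hi ?orbT.
Qed.

(** Taking fibers is a bijection from quasi-shuffles, all n together, onto the list [qs]; the
    prescribed preimage of 0 becomes a condition on the first fiber. *)
Lemma qsh_sumE (V : nmodType) (P : pred nat) (G : seq (seq nat) -> V) : (0 < k + l)%N ->
  qsh_sum P (fun n q => G (fibers q)) =
  (\sum_(L <- qs (iota 0 k) (iota k l) |
      head [::] L == [seq i <- iota 0 (k + l) | P i]) G L)%R.
Proof.
move=> kl; rewrite /qsh_sum.
pose c L := head [::] L == [seq i <- iota 0 (k + l) | P i].
have hc n (q : Qsh k l n) : [forall i, (val q i == 0 :> nat) == P i] = c (fibers q).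
  (* For n = 0 there is no quasi-shuffle, because k + l > 0. *)
  rewrite /c; case: n q => [|n] q.
    by case: (val q (Ordinal kl)).
  rewrite fibersE /= /fib -filter_cat cat_iota.
  apply/forallP/eqP => [h|h i].
    apply: eq_in_filter => i; rewrite mem_iota /= => hi.
    by rewrite -[i]/(val (Ordinal hi)) qsh_funE (eqP (h _)).
  rewrite -qsh_funE; have hi : val i \in iota 0 (k + l) by rewrite mem_iota /=.
  have /(congr1 (fun L => val i \in L)) := h.
  by rewrite !mem_filter hi !andbT => ->.
transitivity (\sum_(L <- [seq fibers q | n : 'I_(k + l).+1 <- index_enum _,
                            q : Qsh k l n <- index_enum _] | c L) G L)%R.
  rewrite [RHS]big_mkcond [RHS]big_allpairs_dep; apply: eq_bigr => n _.
  by rewrite -[RHS]big_mkcond; apply: eq_bigl => q; rewrite hc.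
apply/perm_big/uniq_perm.
- apply: allpairs_uniq_dep; rewrite ?index_enum_uniq //.
    by move=> n _; rewrite index_enum_uniq.
  (* n is the number of fibers, hence is determined by their sequence. *)
  move=> [n p] [m q] _ _ /= h.
  have e : n = m by apply/val_inj; rewrite /= -(size_fibers p) h size_fibers.
  by case: m / e q h => q /fibers_inj ->.
- by apply: uniq_qs; rewrite cat_iota iota_uniq.
- move=> L; apply/allpairsPdep/idP => [[n [q [_ _ ->]]]|hL].
    by rewrite fibersE; apply/fib_qs/qsh_fun_on.
  have [q hq] := fibers_surj hL.
  have hn : (size L < (k + l).+1)%N.
    by rewrite ltnS (leq_trans (size_qs hL)) // !size_iota.
  by exists (Ordinal hn), q; rewrite !mem_index_enum; split => //.
Qed.

End Fibers.

(** * The three products as sums over [qs] *)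

Section Letters.
Local Open Scope ring_scope.
Variables (V : nmodType) (T : Type) (H : seq (seq T) -> V).
Variables (f : nat -> T) (k l : nat) (a b : T) (u v : seq T).
Hypothesis f_left : map f (iota 0 k.+1) = a :: u.
Hypothesis f_right : map f (iota k.+1 l.+1) = b :: v.
Let F n (q : Qsh k.+1 l.+1 n) := H [seq [seq f i | i <- fiber q m] | m <- enum 'I_n].

Let qsh_sum_letters (P : pred nat) : qsh_sum P F =
  \sum_(L <- qs (iota 0 k.+1) (iota k.+1 l.+1) |
     head [::] L == [seq i <- iota 0 (k.+1 + l.+1) | P i]) H (map (map f) L).
Proof.
rewrite -(@qsh_sumE k.+1 l.+1 _ _ (fun L => H (map (map f) L))) // /qsh_sum.
apply: eq_bigr => n _; apply: eq_bigr => q _.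
by rewrite /fibers -map_comp.
Qed.

Let f_left' : map f (iota 1 k) = u. Proof. by case: f_left. Qed.
Let f_right' : map f (iota k.+2 l) = v. Proof. by case: f_right. Qed.
Let f0 : f 0%N = a. Proof. by case: f_left. Qed.
Let fk : f k.+1 = b. Proof. by case: f_right. Qed.

Let sum_headN (P x : seq nat) U W : P != x ->
  \sum_(L <- map (cons x) (qs U W) | head [::] L == P) H (map (map f) L) = 0.
Proof. by move=> h; rewrite big_map /= big_pred0 // => L; rewrite eq_sym (negPf h). Qed.

Let sum_head (P x : seq nat) U W : P = x ->
  \sum_(L <- map (cons x) (qs U W) | head [::] L == P) H (map (map f) L) =
  \sum_(L <- qs (map f U) (map f W)) H (map f x :: L).
Proof. by move=> <-; rewrite qs_map !big_map /= eqxx. Qed.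

Let sum_cat3 I (r1 r2 r3 : seq I) (P : pred I) (G : I -> V) :
  \sum_(i <- r1 ++ r2 ++ r3 | P i) G i =
  \sum_(i <- r1 | P i) G i + \sum_(i <- r2 | P i) G i + \sum_(i <- r3 | P i) G i.
Proof. by rewrite !big_cat /= addrA. Qed.

Let uniq_i : uniq (iota 0 (k.+1 + l.+1)). Proof. exact: iota_uniq. Qed.

Let qs_split : qs (iota 0 k.+1) (iota k.+1 l.+1) =
  map (cons [:: 0%N]) (qs (iota 1 k) (iota k.+1 l.+1))
  ++ map (cons [:: k.+1]) (qs (iota 0 k.+1) (iota k.+2 l))
  ++ map (cons [:: 0%N; k.+1]) (qs (iota 1 k) (iota k.+2 l)).
Proof. by []. Qed.

(** The recursion of [qs] sorts the quasi-shuffles by their first fiber, which is {0}, {k + 1} or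
    both; the condition defining each product selects exactly one of the three summands. *)
Lemma qsh_sum_prec :
  qsh_sum (qprec k.+1) F = \sum_(L <- qs u (b :: v)) H ([:: a] :: L).
Proof.
rewrite qsh_sum_letters qs_split sum_cat3.
have -> : [seq i <- iota 0 (k.+1 + l.+1) | qprec k.+1 i] = [:: 0%N].
  exact: (filter_pred1_uniq uniq_i).
by rewrite sum_head // !sum_headN // !addr0 f_left' f_right /= f0.
Qed.

Lemma qsh_sum_succ :
  qsh_sum (qsucc k.+1) F = \sum_(L <- qs (a :: u) v) H ([:: b] :: L).
Proof.
rewrite qsh_sum_letters qs_split sum_cat3.
have -> : [seq i <- iota 0 (k.+1 + l.+1) | qsucc k.+1 i] = [:: k.+1].
  apply: (filter_pred1_uniq uniq_i).
  by rewrite mem_iota /= add0n addSn ltnS addnS ltnS leq_addr.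
by rewrite sum_headN // sum_head // sum_headN // add0r addr0 f_left f_right' /= fk.
Qed.

Lemma qsh_sum_dot :
  qsh_sum (qdot k.+1) F = \sum_(L <- qs u v) H ([:: a; b] :: L).
Proof.
rewrite qsh_sum_letters qs_split sum_cat3.
have -> : [seq i <- iota 0 (k.+1 + l.+1) | qdot k.+1 i] = [:: 0%N; k.+1].
  rewrite /= /qdot /=; congr (_ :: _).
  rewrite -(@filter_pred1_uniq _ (iota 1 (k + l.+1)) k.+1) ?iota_uniq //.
    by apply: eq_in_filter => i; rewrite mem_iota; case: i.
  by rewrite mem_iota /= add1n ltnS addnS ltnS leq_addr.
rewrite (@sum_headN _ [:: 0%N]) // (@sum_headN _ [:: k.+1]) // sum_head // !add0r.
by rewrite f_left' f_right' /= f0 fk.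
Qed.

End Letters.

Lemma raddf_qsh_sum (V W : nmodType) (g : {additive V -> W}) k l P
    (F : forall n, Qsh k l n -> V) :
  g (qsh_sum P F) = qsh_sum P (fun n q => g (F n q)).
Proof. by rewrite raddf_sum; apply: eq_bigr => n _; rewrite raddf_sum. Qed.

Lemma eq_qsh_sum (V : nmodType) k l P (F G : forall n, Qsh k l n -> V) :
  (forall n q, F n q = G n q) -> qsh_sum P F = qsh_sum P G.
Proof. by move=> h; apply: eq_bigr => n _; apply: eq_bigr => q _. Qed.

End QuasiShuffleLists.

(** * The quasi-shuffle algebra of words *)

Lemma padd_comm : commutative padd.
Proof. by move=> a b; apply: val_inj; rewrite /= addnC. Qed.

Lemma padd_assoc : associative padd.
Proof. by move=> a b c; apply: val_inj; rewrite /= addnA. Qed.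

(* The operations are abstract because comparing concrete elements of Words R up
   to conversion is intractable; for the same reason, several proofs below chain
   explicit equalities instead of rewriting. *)
Section AbstractQuasiShuffle.
Local Open Scope ring_scope.
Variables (V : zmodType) (st : V -> V -> V) (wc : posnat -> V -> V).
Hypothesis st_Dl : forall z x y, st (x + y) z = st x z + st y z.
Hypothesis st_Dr : forall z x y, st z (x + y) = st z x + st z y.
Hypothesis wc_D : forall a x y, wc a (x + y) = wc a x + wc a y.
Hypothesis st_wc : forall a x b y, st (wc a x) (wc b y) =
  wc a (st x (wc b y)) + wc b (st (wc a x) y) + wc (padd a b) (st x y).

(** The three hypotheses are associativity after removing the first letter a, b or c respectively;
    [st_wc] reduces every term to one of these cases. *)
Lemma quasi_shuffle_assoc_step a u b v c w :
  (forall y z, st u (st y z) = st (st u y) z) ->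
  (forall z, st (wc a u) (st v z) = st (st (wc a u) v) z) ->
  st (wc a u) (st (wc b v) w) = st (st (wc a u) (wc b v)) w ->
  st (wc a u) (st (wc b v) (wc c w)) = st (st (wc a u) (wc b v)) (wc c w).
Proof.
move=> IH1 IH2 IH3.
rewrite (st_wc b v c w) (st_wc a u b v) 2!st_Dr 2!st_Dl.
rewrite (st_wc a u b) (st_wc a u c) (st_wc a u (padd b c)).
rewrite (st_wc a _ c) (st_wc b _ c) (st_wc (padd a b) _ c).
(* Full expansion gives nine terms on each side. The left one that starts with c and the right one
   that starts with a each split into three, and the resulting eleven terms match up to order. *)
have -> : wc c (st (wc a u) (st (wc b v) w)) = wc c (st (wc a (st u (wc b v))) w)
    + wc c (st (wc b (st (wc a u) v)) w) + wc c (st (wc (padd a b) (st u v)) w).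
  by rewrite IH3 (st_wc a u b v) 2!st_Dl 2!wc_D.
have -> : wc a (st (st u (wc b v)) (wc c w)) = wc a (st u (wc b (st v (wc c w))))
    + wc a (st u (wc c (st (wc b v) w))) + wc a (st u (wc (padd b c) (st v w))).
  by rewrite -IH1 (st_wc b v c w) 2!st_Dr 2!wc_D.
rewrite !IH1 !IH2 padd_assoc !addrA.
by rewrite [LHS](ACl (1*4*9*5*8*2*6*10*3*7*11)).
Qed.

Variable one : V.
Hypothesis st_A : associative st.
Hypothesis st_C : commutative st.
Hypothesis st_1l : left_id one st.

Section SumOverQuasiShuffles.
Variables (T : Type) (w : T -> posnat) (x : T -> V) (node : seq T -> V -> V).
Variables goodl goodr : pred T.
Hypothesis node1l : forall y z, goodl y -> node [:: y] z = wc (w y) (st (x y) z).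
Hypothesis node1r : forall y z, goodr y -> node [:: y] z = wc (w y) (st (x y) z).
Hypothesis node2 : forall y y' z, goodl y -> goodr y' ->
  node [:: y; y'] z = wc (padd (w y) (w y')) (st (st (x y) (x y')) z).

Definition ladder (u : seq T) : V := foldr (fun y z => wc (w y) (st (x y) z)) one u.

Let ladder_node (g : pred T) u :
  (forall y z, g y -> node [:: y] z = wc (w y) (st (x y) z)) ->
  all g u -> foldr node one [seq [:: y] | y <- u] = ladder u.
Proof. by move=> h; elim: u => //= y u IH /andP[gy /IH ->]; rewrite h. Qed.

Let wst_sum a z (r : seq (seq (seq T))) :
  \sum_(L <- r) wc a (st z (foldr node one L))
  = wc a (st z (\sum_(L <- r) foldr node one L)).
Proof.
have h0 (h : V -> V) : {morph h : y z / y + z} -> h 0 = 0.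
  by move=> hD; apply: (addrI (h 0)); rewrite -hD !addr0.
elim: r => [|L r IH]; last by rewrite !big_cons IH st_Dr wc_D.
by rewrite !big_nil (h0 _ (st_Dr z)) (h0 _ (wc_D a)).
Qed.

(** Multiplying two ladders with [st_wc] produces the same three-branch recursion as [qs];
    associativity and commutativity then bring the factors carried by the first fiber to the
    front. *)
Lemma sum_qs u v : all goodl u -> all goodr v ->
  \sum_(L <- qs u v) foldr node one L = st (ladder u) (ladder v).
Proof.
elim: u v => [|a u IHu] v gu gv.
  by rewrite qs0l big_seq1 (ladder_node node1r) // st_1l.
elim: v gv => [|b v IHv] gv.
  by rewrite qs0r big_seq1 (ladder_node node1l) // st_C st_1l.
have [/andP[ga gu'] /andP[gb gv']] := (gu, gv).
rewrite qs_cons !big_cat !big_map /= (st_wc (w a)) -addrA; congr (_ + (_ + _)).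
- under eq_bigr => L _ do rewrite node1l //.
  by rewrite wst_sum IHu // st_A.
- under eq_bigr => L _ do rewrite node1r //.
  by rewrite wst_sum IHv // st_A (st_C (x b)) -st_A.
- under eq_bigr => L _ do rewrite node2 //.
  by rewrite wst_sum IHu // -!st_A (st_A (x b)) (st_C (x b)) -!st_A.
Qed.

Lemma sum_qs_prec a u v : goodl a -> all goodl u -> all goodr v ->
  \sum_(L <- qs u v) foldr node one ([:: a] :: L)
  = wc (w a) (st (st (x a) (ladder u)) (ladder v)).
Proof.
move=> ga gu gv /=; under eq_bigr => L _ do rewrite node1l //.
by rewrite wst_sum sum_qs // st_A.
Qed.

Lemma sum_qs_succ b u v : goodr b -> all goodl u -> all goodr v ->
  \sum_(L <- qs u v) foldr node one ([:: b] :: L)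
  = wc (w b) (st (ladder u) (st (x b) (ladder v))).
Proof.
move=> ga gu gv /=; under eq_bigr => L _ do rewrite node1r //.
by rewrite wst_sum sum_qs // st_A (st_C (x b)) -st_A.
Qed.

Lemma sum_qs_dot a b u v : goodl a -> goodr b -> all goodl u -> all goodr v ->
  \sum_(L <- qs u v) foldr node one ([:: a; b] :: L)
  = wc (padd (w a) (w b)) (st (st (x a) (ladder u)) (st (x b) (ladder v))).
Proof.
move=> ga gb gu gv /=; under eq_bigr => L _ do rewrite node2 //.
by rewrite wst_sum sum_qs // -!st_A (st_A (x b)) (st_C (x b)) -!st_A.
Qed.

End SumOverQuasiShuffles.

End AbstractQuasiShuffle.

Section Star.
Local Open Scope ring_scope.
Variable R : realType.
Implicit Types (a b c : posnat) (u v w : word) (x y z : Words R).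

HB.instance Definition _ a := GRing.Linear.copy (@wcons R a) (lin_ext _).

Lemma wcons_bas a w : wcons a (bas R w) = bas R (a :: w).
Proof. exact: lin_ext_bas. Qed.

HB.instance Definition _ x := GRing.Linear.copy (@star R x) (bilin (@qshuffle R) x).

Lemma starP k x y z : star (k *: x + y) z = k *: star x z + star y z.
Proof. exact: bilinP. Qed.

Lemma starDl z : {morph (@star R)^~ z : x y / x + y}.
Proof. by move=> x y; rewrite -[x]scale1r starP !scale1r. Qed.

Lemma star0l z : star 0 z = 0.
Proof. exact: (linear0 (lin_ext (fun u => lin_ext (qshuffle R u) z))). Qed.

Lemma star_bas u v : star (bas R u) (bas R v) = qshuffle R u v.
Proof. exact: bilin_bas. Qed.

Lemma qshuffle0r u : qshuffle R u [::] = bas R u.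
Proof. by case: u. Qed.

Lemma qshuffle0l v : qshuffle R [::] v = bas R v.
Proof. by case: v. Qed.

Lemma qshuffle_cons a u b v :
  qshuffle R (a :: u) (b :: v) = wcons a (qshuffle R u (b :: v))
    + wcons b (qshuffle R (a :: u) v) + wcons (padd a b) (qshuffle R u v).
Proof. by []. Qed.

Lemma star1l : left_id (bas R [::]) (@star R).
Proof.
move=> x; elim/malg_ind: x => [|k|a x y hx hy]; first exact: linear0.
  by rewrite star_bas; case: k.
by rewrite linearP /= hx hy.
Qed.

Lemma star1r : right_id (bas R [::]) (@star R).
Proof.
move=> x; elim/malg_ind: x => [|k|a x y hx hy]; first exact: star0l.
  by rewrite star_bas qshuffle0r.
by rewrite starP hx hy.
Qed.

Lemma star_wcons a x b y :
  star (wcons a x) (wcons b y) = wcons a (star x (wcons b y))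
    + wcons b (star (wcons a x) y) + wcons (padd a b) (star x y).
Proof.
elim/malg_ind: x => [|u|k x1 x2 h1 h2].
- by rewrite [wcons a 0]linear0 !star0l !linear0 !addr0.
- elim/malg_ind: y => [|v|k y1 y2 h1 h2].
  + by rewrite !linear0 !addr0.
  + by rewrite !wcons_bas !star_bas qshuffle_cons.
  + by rewrite !linearP /= h1 h2 !scalerDr addrACA [X in X + _]addrACA.
- by rewrite linearP /= !starP !linearP /= h1 h2 !scalerDr addrACA [X in X + _]addrACA.
Qed.

Lemma qshuffleC u v : qshuffle R u v = qshuffle R v u.
Proof.
elim: u v => [|a u IHu] v; first by rewrite qshuffle0l qshuffle0r.
elim: v => [|b v IHv]; first by rewrite qshuffle0l qshuffle0r.
have swap (p q r p' q' r' : Words R) :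
    p = q' -> q = p' -> r = r' -> p + q + r = p' + q' + r'.
  by move=> -> -> ->; rewrite [q' + _]addrC.
have h := swap _ _ _ _ _ _ (congr1 (wcons a) (IHu (b :: v))) (congr1 (wcons b) IHv)
  (congr2 (@wcons R) (padd_comm a b) (IHu v)).
exact (etrans (qshuffle_cons a u b v) (etrans h (esym (qshuffle_cons b v a u)))).
Qed.

Lemma starC : commutative (@star R).
Proof.
move=> x y; elim/malg_ind: x => [|u|k x1 x2 h1 h2]; first by rewrite star0l linear0.
  elim/malg_ind: y => [|v|k y1 y2 h1 h2]; first by rewrite star0l linear0.
    exact: etrans (star_bas u v) (etrans (qshuffleC u v) (esym (star_bas v u))).
  by rewrite linearP /= starP h1 h2.
by rewrite linearP /= starP h1 h2.
Qed.

Lemma starA_ext_r x y :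
  (forall w, star x (star y (bas R w)) = star (star x y) (bas R w)) ->
  forall z, star x (star y z) = star (star x y) z.
Proof.
move=> h; elim/malg_ind => [|w|k z1 z2 h1 h2]; [by rewrite !linear0|exact: h|].
by rewrite !linearP /= h1 h2.
Qed.

Lemma starA_ext_m x :
  (forall v z, star x (star (bas R v) z) = star (star x (bas R v)) z) ->
  forall y z, star x (star y z) = star (star x y) z.
Proof.
move=> h y z; elim/malg_ind: y => [|v|k y1 y2 h1 h2]; [|exact: h|].
  by rewrite star0l linear0 star0l.
by rewrite starP !linearP /= starP h1 h2.
Qed.

Lemma starA_ext_l :
  (forall u y z, star (bas R u) (star y z) = star (star (bas R u) y) z) ->
  forall x y z, star x (star y z) = star (star x y) z.
Proof.
move=> h x y z; elim/malg_ind: x => [|v|k y1 y2 h1 h2]; [|exact: h|].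
  by rewrite !star0l.
by rewrite !starP h1 h2.
Qed.

Lemma starA1l x y : star (bas R [::]) (star x y) = star (star (bas R [::]) x) y.
Proof. by rewrite !star1l. Qed.

Lemma starA1m x y : star x (star (bas R [::]) y) = star (star x (bas R [::])) y.
Proof. by rewrite star1l star1r. Qed.

Lemma starA1r x y : star x (star y (bas R [::])) = star (star x y) (bas R [::]).
Proof. by rewrite !star1r. Qed.

(** The arguments are reduced to words one at a time, so that each induction hypothesis still
    quantifies over arbitrary elements in the later arguments: the products it is applied to are not
    words. *)
Lemma starA : associative (@star R).
Proof.
apply: starA_ext_l; elim=> [|a u IHu]; first exact: starA1l.
apply: starA_ext_m; elim=> [|b v IHv]; first exact: starA1m.
apply: starA_ext_r; elim=> [|c w IHw]; first exact: starA1r.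
move: IHv IHw.
rewrite -(wcons_bas a u) -(wcons_bas b v) -(wcons_bas c w) => IHv IHw.
exact (quasi_shuffle_assoc_step starDl (fun x => linearD (star x))
         (fun a => linearD (wcons a)) star_wcons c IHu IHv IHw).
Qed.

HB.instance Definition _ :=
  Monoid.isComLaw.Build (Words R) (bas R [::]) (@star R) starA starC star1l.
Definition star_sum_qs := sum_qs (fun x => linearD (star x))
  (fun a => linearD (wcons a)) star_wcons starA starC star1l.

Definition star_sum_qs_prec := sum_qs_prec (fun x => linearD (star x))
  (fun a => linearD (wcons a)) star_wcons starA starC star1l.

Definition star_sum_qs_succ := sum_qs_succ (fun x => linearD (star x))
  (fun a => linearD (wcons a)) star_wcons starA starC star1l.

Definition star_sum_qs_dot := sum_qs_dot (fun x => linearD (star x))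
  (fun a => linearD (wcons a)) star_wcons starA starC star1l.

End Star.

(** * Formal series *)

Section FormalSeriesFree.
Local Open Scope ring_scope.
Local Open Scope quotient_scope.
Variable R : realType.

(** The zero tuple lies outside every region of summation: the entries of a chain are positive, and
    in length 0, where it is the empty tuple, the region of the unit is empty. *)
Definition avoids0 d (A : pset d) : R :=
  if `[< A [tuple of nseq d 0%N] >] then 0 else 1.

Lemma bas_mul d (A B : pset d) : bas R A * bas R B = bas R (A `|` B : pset d).
Proof. by rewrite malgM_def fgmulUU mulr1. Qed.

(* A |-> [0 \notin A] extends to an algebra morphism, whose kernel is an ideal. *)
Lemma lin_avoids0_modular d x : modular_ideal (R := R) (d := d) x ->
  lin_ext (V := R^o) (@avoids0 d) x = 0.
Proof.
pose chi : {linear malg (pset d) R -> R^o} := lin_ext (V := R^o) (@avoids0 d).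
(* Vanishing of all multiples of x is a property that is visibly closed under the ideal
   operations. *)
move=> hx; suff h y : chi (y * x) = 0 by rewrite -[x]mul1r; apply: h.
move: x hx y; apply: smallest_sub => [|_ [A [B ->]] y].
  split => [y|x x' hx hx' y|a x hx y]; first by rewrite mulr0 linear0.
    by rewrite mulrDr linearD /= hx hx' addr0.
  by rewrite mulrA.
elim/malg_ind: y => [|C|a y1 y2 h1 h2]; first by rewrite mul0r linear0.
  rewrite mulrDr !mulrBr !bas_mul linearD !linearB /= /chi !lin_ext_bas /avoids0.
  (* With p = [0 \notin A] and q = [0 \notin B], the union has value p q and the intersection p + q
     - p q, so the generators vanish; multiplying by C keeps this. *)
  have U (X Y : pset d) z : `[< (X `|` Y) z >] = `[< X z >] || `[< Y z >].
    exact: asbool_or.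
  have I (X Y : pset d) z : `[< (X `&` Y) z >] = `[< X z >] && `[< Y z >].
    exact: asbool_and.
  rewrite !U I; case: asbool; case: asbool; case: asbool => /=;
    by rewrite ?(subr0, subrr, addr0, sub0r, addNr).
by rewrite mulrDl -scalerAl linearP /= h1 h2 scaler0 addr0.
Qed.

Definition fs_word0 (t : {w : word & pset (size w)}) : Words R :=
  avoids0 (tagged t) *: bas R (tag t).

Lemma fs_word0_rel x : FS_rel (R := R) x -> lin_ext fs_word0 x = 0.
Proof.
move=> hx; apply: (@lspan_min _ _ _ [set y | lin_ext fs_word0 y = 0] _ _ x hx).
  split=> [|a y z hy hz] /=; first by rewrite linear0.
  by rewrite linearP /= hy hz scaler0 addr0.
move=> _ [w [y hy ->]] /=; rewrite /preFS_in linear_lin_ext.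
transitivity (lin_ext (V := R^o) (@avoids0 (size w)) y *: bas R w).
  rewrite /lin_ext scaler_suml; apply: eq_bigr => A _ /=.
  by rewrite lin_ext_bas scalerA.
by rewrite lin_avoids0_modular // scale0r.
Qed.

(** [fs_word0] vanishes on the relations, hence induces a map [Phi] from the quotient to words,
    computed on representatives; it sends [fs_gen w] back to w and is therefore a left inverse. *)
Lemma fs_gen_inj : injective (lin_ext (@fs_gen R)).
Proof.
pose g w : malg {w : word & pset (size w)} R :=
  bas R (Tagged (fun w => pset (size w)) (fs_region w)).
have pi_lin c : lin_ext (@fs_gen R) c = \pi_(FS R) (lin_ext g c).
  rewrite /lin_ext raddf_sum; apply: eq_bigr => w _ /=.
  by rewrite pi_FS_scale.
pose Phi (x : FS R) := lin_ext fs_word0 (repr x).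
have PhiE x : Phi (\pi_(FS R) x) = lin_ext fs_word0 x.
  apply/eqP; rewrite -subr_eq0 -linearB; apply/eqP/fs_word0_rel.
  suff /asboolP : repr (\pi_(FS R) x) - x \in @FS_relb R by [].
  by rewrite Quotient.idealrBE reprK.
apply: (can_inj (g := Phi)) => c; rewrite pi_lin PhiE linear_lin_ext -[RHS]lin_ext_id.
apply: eq_lin_ext => w /=; rewrite lin_ext_bas /fs_word0 /= /avoids0.
(* Only the impossible case remains: the zero tuple would belong to [fs_region w]. *)
case: asboolP; last by rewrite scale1r.
rewrite /fs_region; case: eqVneq => [_ []|]; case: w => [|a w] // _.
by move=> /andP[_] /=.
Qed.

End FormalSeriesFree.

(** * From words to formal series: [zetaFS] is a morphism *)

Section WordsMorphism.
Local Open Scope ring_scope.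
Variable R : realType.
Implicit Types (a b : posnat) (u v w : word).

(** The case of [sum_qs] in which every letter carries the unit: the ladder of a word is then the
    word itself. *)
Lemma sum_qs_words u v : \sum_(L <- qs u v) bas R (map psum L) = qshuffle R u v.
Proof.
pose one : Words R := bas R [::].
pose node (f : seq posnat) (z : Words R) := wcons (psum f) z.
have nodeE (L : seq (seq posnat)) : foldr node one L = bas R (map psum L).
  by elim: L => //= f L ->; apply: wcons_bas.
under eq_bigr => L _ do rewrite -nodeE.
have h1 (y : posnat) z : predT y -> node [:: y] z = wcons y (star one z).
  by rewrite star1l.
have h2 (y y' : posnat) z : predT y -> predT y' ->
    node [:: y; y'] z = wcons (padd y y') (star (star one one) z).
  by rewrite !star1l.
rewrite (star_sum_qs h1 h1 h2) ?all_predT //.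
have ladderE x : ladder (@star R) (@wcons R) one id (fun=> one) x = bas R x.
  by elim: x => //= a x ->; rewrite star1l; apply: wcons_bas.
by rewrite !ladderE star_bas.
Qed.

Let nth_left u v : map (nth pone (u ++ v)) (iota 0 (size u)) = u.
Proof. by rewrite map_nth_iota0 ?take_size_cat // size_cat leq_addr. Qed.

Let nth_right u v : map (nth pone (u ++ v)) (iota (size u) (size v)) = v.
Proof.
rewrite map_nth_iota ?size_cat ?addKn //.
by rewrite drop_size_cat // take_size.
Qed.

Let fs_qshE P u v : fs_qsh R P u v =
  qsh_sum (k := size u) (l := size v) (P (size u)) (fun n q =>
    fs_gen R (map psum
      [seq [seq nth pone (u ++ v) i | i <- fiber q m] | m <- enum 'I_n])).
Proof. by apply: eq_qsh_sum => n q; rewrite -map_comp. Qed.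

Lemma zetaFS_wcons a x : zetaFS R (wcons a x) = lin_ext (fun w => fs_gen R (a :: w)) x.
Proof.
rewrite /zetaFS /wcons linear_lin_ext; apply: eq_lin_ext => w.
exact: lin_ext_bas.
Qed.

Let zetaFS_sum a u v :
  zetaFS R (wcons a (qshuffle R u v)) = \sum_(L <- qs u v) fs_gen R (a :: map psum L).
Proof.
rewrite zetaFS_wcons -sum_qs_words linear_sum; apply: eq_bigr => L _.
exact: lin_ext_bas.
Qed.

Lemma zetaFS_morphism :
  @tridend_morphism R (words_tridend R) (S_tridend R) (zetaFS R).
Proof.
apply: (tridend_on_morphism (c := @bas R word) (f := lin_ext (@fs_gen R))).
- exact: fs_gen_inj.
- by [].
- by [].
- by move=> w hw; rewrite /bas msuppU oner_eq0 in_fset1 eq_sym.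
move=> [|a u]; first by [].
move=> [|b v]; first by [].
move=> _ _; rewrite !bilin_bas !fs_qshE.
have hl := nth_left (a :: u) (b :: v).
have hr := nth_right (a :: u) (b :: v).
split.
- rewrite (qsh_sum_prec (fun L => fs_gen R (map psum L)) hl hr).
  exact: zetaFS_sum.
- rewrite (qsh_sum_succ (fun L => fs_gen R (map psum L)) hl hr).
  exact: zetaFS_sum.
- rewrite (qsh_sum_dot (fun L => fs_gen R (map psum L)) hl hr).
  exact: zetaFS_sum.
Qed.

End WordsMorphism.

(** * The morphism from trees to words *)

Section FlatIota.
Local Open Scope ring_scope.
Variable R : realType.
Implicit Types (t s : ptree word).

Definition flat_angle t : Words R := flat_ptree R (angle_sums t).

Definition flat_forest (ts : seq (ptree word)) : Words R :=
  foldr (@star R) (bas R [::]) (map flat_angle ts).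

Lemma flat_angle_node w ts : flat_angle (Node w ts) = wcons (psum w) (flat_forest ts).
Proof. by rewrite /flat_angle /= -map_comp. Qed.

Lemma flat_forest_cat ts ts' :
  flat_forest (ts ++ ts') = star (flat_forest ts) (flat_forest ts').
Proof.
elim: ts => [|t ts IH]; first by rewrite star1l.
by rewrite /flat_forest /= -/(flat_forest _) IH starA.
Qed.

Lemma flat_forest1 t : flat_forest [:: t] = flat_angle t.
Proof. exact: star1r. Qed.

(* A vertex of the ladder, with the forest grafted to its left (true) or to its
   right (false). *)
Definition letter : Type := bool * (word * seq (ptree word)).

Definition letter_val (y : letter) : Words R := flat_forest y.2.2.
Definition letter_psum (y : letter) : posnat := psum y.2.1.

(** Empty words are excluded because [psum] takes a default value there and would no longer be
    additive under concatenation. *)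
Definition good_left (y : letter) : bool := y.1 && (0 < size y.2.1)%N.
Definition good_right (y : letter) : bool := ~~ y.1 && (0 < size y.2.1)%N.

Definition node_tree (f : seq letter) (t : ptree word) : ptree word :=
  Node (flatten [seq y.2.1 | y <- f])
    (flatten [seq y.2.2 | y <- f & y.1] ++ t :: flatten [seq y.2.2 | y <- f & ~~ y.1]).

Definition node_flat (f : seq letter) (z : Words R) : Words R :=
  wcons (psum (flatten [seq y.2.1 | y <- f]))
    (star (flat_forest (flatten [seq y.2.2 | y <- f & y.1]))
       (star z (flat_forest (flatten [seq y.2.2 | y <- f & ~~ y.1])))).

Lemma flat_node_tree (L : seq (seq letter)) :
  flat_angle (foldr node_tree Leaf L) = foldr node_flat (bas R [::]) L.
Proof.
elim: L => //= f L IH; rewrite flat_angle_node flat_forest_cat -cat1s flat_forest_cat.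
by rewrite flat_forest1 IH.
Qed.

Lemma psum_cat u v : (0 < size u)%N -> (0 < size v)%N ->
  psum (u ++ v) = padd (psum u) (psum v).
Proof.
case: u v => [|a u] // [|b v] // _ _ /=; rewrite foldl_cat /=.
by elim: v b => //= c v IH b; rewrite -IH padd_assoc.
Qed.

Lemma node_flat1l y z : good_left y ->
  node_flat [:: y] z = wcons (letter_psum y) (star (letter_val y) z).
Proof.
by move=> /andP[h _]; rewrite /node_flat /= h /= !cats0 star1r.
Qed.

Lemma node_flat1r y z : good_right y ->
  node_flat [:: y] z = wcons (letter_psum y) (star (letter_val y) z).
Proof.
by move=> /andP[/negPf h _]; rewrite /node_flat /= h /= !cats0 star1l starC.
Qed.

Lemma node_flat2 y y' z : good_left y -> good_right y' ->
  node_flat [:: y; y'] z =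
  wcons (padd (letter_psum y) (letter_psum y'))
    (star (star (letter_val y) (letter_val y')) z).
Proof.
move=> /andP[h hy] /andP[/negPf h' hy']; rewrite /node_flat /= h h' /= !cats0.
by rewrite (psum_cat hy hy') (starC z) starA.
Qed.

Definition flat_ladder :=
  ladder (@star R) (@wcons R) (bas R [::]) letter_psum letter_val.

Definition lefts t : seq letter := map (pair true) (rbranch t).
Definition rights t : seq letter := map (pair false) (lbranch t).

Lemma all_good_left t : tri_wf t -> all good_left (lefts t).
Proof. by move=> /rbranch_wf; rewrite all_map; apply: sub_all => y /and3P[]. Qed.

Lemma all_good_right t : tri_wf t -> all good_right (rights t).
Proof. by move=> /lbranch_wf; rewrite all_map; apply: sub_all => y /and3P[]. Qed.

Lemma flat_lefts t : tri_wf t -> flat_ladder (lefts t) = flat_angle t.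
Proof.
elim/ptree_nested_ind: t => // w ts IH; rewrite tri_wf_node => /and3P[h2 _ hall].
rewrite flat_angle_node; case: (lastP ts) h2 hall IH => // {}ts t _.
rewrite all_rcons /lefts /= size_rcons /= map_rcons last_rcons => /andP[ht _] IH.
rewrite -cats1 take_size_cat // flat_forest_cat flat_forest1.
congr (wcons _ (star _ _)).
suff : tri_wf t -> flat_ladder (lefts t) = flat_angle t by apply.
by elim: ts IH => [|s ts IHts] [].
Qed.

(** Along the leftmost branch the subtree continuing the branch precedes the grafted forest, whereas
    a ladder multiplies by the forest first; commutativity of [star] reconciles the two orders. *)
Lemma flat_rights t : tri_wf t -> flat_ladder (rights t) = flat_angle t.
Proof.
elim/ptree_nested_ind: t => // w ts IH; rewrite tri_wf_node => /and3P[h2 _ hall].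
rewrite flat_angle_node; case: ts h2 hall IH => [|t ts]; first by [].
move=> _ /andP[ht _] [/(_ ht) IH _].
rewrite -cat1s flat_forest_cat flat_forest1 starC.
by congr (wcons _ (star _ _)).
Qed.

Lemma flat_iotaE x :
  flat R (iota_map R x) = lin_ext (fun t : tritree => flat_angle (val t)) x.
Proof.
rewrite /flat /iota_map linear_lin_ext; apply: eq_lin_ext => -[t wf_t].
exact: lin_ext_bas.
Qed.

Lemma bilin_wprec a x y : bilin (@wprec R) (wcons a x) y = wcons a (star x y).
Proof.
elim/malg_ind: x => [|u|k x1 x2 h1 h2].
- by rewrite linear0 star0l linear0 /bilin linear0.
- elim/malg_ind: y => [|v|k y1 y2 h1 h2]; first by rewrite !linear0.
    by rewrite wcons_bas bilin_bas star_bas.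
  by rewrite !linearP /= h1 h2.
- by rewrite linearP bilinP starP linearP /= h1 h2.
Qed.

Lemma bilin_wsucc x b y : bilin (@wsucc R) x (wcons b y) = wcons b (star x y).
Proof.
elim/malg_ind: x => [|u|k x1 x2 h1 h2].
- by rewrite star0l linear0 /bilin linear0.
- elim/malg_ind: y => [|v|k y1 y2 h1 h2]; first by rewrite !linear0.
    by rewrite wcons_bas bilin_bas star_bas.
  by rewrite !linearP /= h1 h2.
- by rewrite bilinP starP linearP /= h1 h2.
Qed.

Lemma bilin_wdot a x b y :
  bilin (@wdot R) (wcons a x) (wcons b y) = wcons (padd a b) (star x y).
Proof.
elim/malg_ind: x => [|u|k x1 x2 h1 h2].
- by rewrite linear0 star0l linear0 /bilin linear0.
- elim/malg_ind: y => [|v|k y1 y2 h1 h2]; first by rewrite !linear0.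
    by rewrite !wcons_bas bilin_bas star_bas.
  by rewrite !linearP /= h1 h2.
- by rewrite linearP bilinP starP linearP /= h1 h2.
Qed.

(** The support condition of [tridend_on_morphism]: trees other than the leaf flatten into the
    augmentation part. *)
Lemma nil_notin_wcons a x : [::] \notin msupp (@wcons R a x).
Proof.
rewrite -mcoeff_eq0; apply/eqP.
elim/malg_ind: x => [|u|k x1 x2 h1 h2]; first by rewrite linear0 mcoeff0.
  by rewrite wcons_bas mcoeffU.
by rewrite linearP /= mcoeffD mcoeffZ h1 h2 mulr0 addr0.
Qed.

Definition branch_letter t s (i : nat) : letter :=
  ((i < size (rbranch t))%N, nth ([::], [::]) (branches t s) i).

Lemma branch_letter_left t s :
  map (branch_letter t s) (iota 0 (size (rbranch t))) = lefts t.
Proof.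
rewrite /lefts -[X in map (pair true) X](take_size_cat (lbranch s) (erefl _)).
rewrite -(map_nth_iota0 ([::], [::])) ?size_cat ?leq_addr // -map_comp.
by apply/eq_in_map => i; rewrite mem_iota /branch_letter => /andP[_ ->].
Qed.

Lemma branch_letter_right t s :
  map (branch_letter t s) (iota (size (rbranch t)) (size (lbranch s))) = rights s.
Proof.
rewrite /rights -[X in map (pair false) X]take_size.
rewrite -[X in take _ X](drop_size_cat (s1 := rbranch t) (lbranch s) (erefl _)).
rewrite -(map_nth_iota ([::], [::])) ?size_cat ?addKn // -map_comp.
by apply/eq_in_map => i; rewrite mem_iota /branch_letter leqNgt => /andP[/negPf ->].
Qed.

(** Once a letter records its side, a graft depends on each fiber only through the letters in it,
    which is the form required by the sums over [qs]. *)
Lemma graftE t s n (q : Qsh (size (rbranch t)) (size (lbranch s)) n) :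
  graft q = foldr node_tree Leaf
    [seq [seq branch_letter t s i | i <- fiber q m] | m <- enum 'I_n].
Proof.
rewrite /graft; elim: (enum 'I_n) => //= m ms ->; rewrite /node_tree.
move: (fiber q m) => r; rewrite !filter_map -!map_comp.
congr (Node _ (_ ++ _ :: flatten (map _ _))).
by apply: eq_filter => i; rewrite /= leqNgt.
Qed.

(** * Flattening the products of two trees other than the leaf *)

Section Products.
Variables (w w' : word) (ts ts' : seq (ptree word)).
Variables (wft : tri_wf (Node w ts)) (wfs : tri_wf (Node w' ts')).
Let t : tritree := Sub (Node w ts) wft.
Let s : tritree := Sub (Node w' ts') wfs.
Let k := size (last [::] (map rbranch ts)).
Let l := size (head [::] (map lbranch ts')).
Let bl := branch_letter (Node w ts) (Node w' ts').
Let u : seq letter := behead (lefts (Node w ts)).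
Let v : seq letter := behead (rights (Node w' ts')).
Let a : letter := (true, (w, take (size ts).-1 ts)).
Let b : letter := (false, (w', behead ts')).

Let bl_left : map bl (iota 0 k.+1) = a :: u.
Proof. exact: (branch_letter_left (Node w ts) (Node w' ts')). Qed.

Let bl_right : map bl (iota k.+1 l.+1) = b :: v.
Proof. exact: (branch_letter_right (Node w ts) (Node w' ts')). Qed.

Lemma linear_tri_qsh (W : lmodType R) (g : tritree -> W) P :
  lin_ext g (tri_qsh R P t s) =
  qsh_sum (k := k.+1) (l := l.+1) (P k.+1) (fun n q => g (@tri_graft t s n q)).
Proof.
rewrite [LHS]raddf_qsh_sum; apply: eq_qsh_sum => n q.
exact: lin_ext_bas.
Qed.

Let H (L : seq (seq letter)) : Words R := foldr node_flat (bas R [::]) L.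

Let flat_tri_qsh P :
  lin_ext (fun t : tritree => flat_angle (val t)) (tri_qsh R P t s) =
  qsh_sum (k := k.+1) (l := l.+1) (P k.+1)
    (fun n q => H [seq [seq bl i | i <- fiber q m] | m <- enum 'I_n]).
Proof.
rewrite linear_tri_qsh; apply: eq_qsh_sum => n q.
by rewrite [LHS]/= graftE flat_node_tree.
Qed.

Let good_left_au : all good_left (a :: u). Proof. exact: all_good_left wft. Qed.
Let good_right_bv : all good_right (b :: v). Proof. exact: all_good_right wfs. Qed.

Let good_a : good_left a. Proof. by move: good_left_au => /= /andP[]. Qed.
Let good_u : all good_left u. Proof. by move: good_left_au => /= /andP[]. Qed.
Let good_b : good_right b. Proof. by move: good_right_bv => /= /andP[]. Qed.
Let good_v : all good_right v. Proof. by move: good_right_bv => /= /andP[]. Qed.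

Let flat_t : flat_angle (Node w ts) =
  wcons (letter_psum a) (star (letter_val a) (flat_ladder u)).
Proof. exact (esym (flat_lefts wft)). Qed.

Let flat_s : flat_angle (Node w' ts') =
  wcons (letter_psum b) (star (letter_val b) (flat_ladder v)).
Proof. exact (esym (flat_rights wfs)). Qed.

Lemma flat_tri_prec :
  lin_ext (fun t : tritree => flat_angle (val t)) (tri_qsh R qprec t s)
  = bilin (@wprec R) (flat_angle (Node w ts)) (flat_angle (Node w' ts')).
Proof.
apply (etrans (flat_tri_qsh _)); apply (etrans (qsh_sum_prec H bl_left bl_right)).
apply (etrans (star_sum_qs_prec node_flat1l node_flat1r node_flat2
  good_a good_u good_right_bv)).
apply esym; apply (etrans (congr2 (bilin (@wprec R)) flat_t flat_s)).
exact (bilin_wprec _ _ _).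
Qed.

Lemma flat_tri_succ :
  lin_ext (fun t : tritree => flat_angle (val t)) (tri_qsh R qsucc t s)
  = bilin (@wsucc R) (flat_angle (Node w ts)) (flat_angle (Node w' ts')).
Proof.
apply (etrans (flat_tri_qsh _)); apply (etrans (qsh_sum_succ H bl_left bl_right)).
apply (etrans (star_sum_qs_succ node_flat1l node_flat1r node_flat2
  good_b good_left_au good_v)).
apply esym; apply (etrans (congr2 (bilin (@wsucc R)) flat_t flat_s)).
exact (bilin_wsucc _ _ _).
Qed.

Lemma flat_tri_dot :
  lin_ext (fun t : tritree => flat_angle (val t)) (tri_qsh R qdot t s)
  = bilin (@wdot R) (flat_angle (Node w ts)) (flat_angle (Node w' ts')).
Proof.
apply (etrans (flat_tri_qsh _)); apply (etrans (qsh_sum_dot H bl_left bl_right)).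
apply (etrans (star_sum_qs_dot node_flat1l node_flat1r node_flat2
  good_a good_b good_u good_v)).
apply esym; apply (etrans (congr2 (bilin (@wdot R)) flat_t flat_s)).
exact (bilin_wdot _ _ _ _).
Qed.

End Products.

Lemma flat_morphism : @tridend_morphism R (tri_tridend R) (words_tridend R)
  (lin_ext (fun t : tritree => flat_angle (val t))).
Proof.
apply: (tridend_on_morphism (c := fun t : tritree => flat_angle (val t))
          (f := lin_ext (fun t : tritree => flat_angle (val t)))).
- exact: bas_inj.
- by move=> k; exact (etrans (lin_ext_bas _ _) (esym (lin_ext_id _))).
- by [].
- case=> -[|w ts] wf ht; last by rewrite flat_angle_node; apply: nil_notin_wcons.
  by case/eqP: ht; apply: val_inj.
case=> -[|w ts] wft s ht; first by case/eqP: ht; apply: val_inj.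
case: s => -[|w' ts'] wfs hs; first by case/eqP: hs; apply: val_inj.
split; [exact: flat_tri_prec|exact: flat_tri_succ|exact: flat_tri_dot].
Qed.

End FlatIota.

(** * Uniqueness of morphisms from trees *)

Section Uniqueness.
Local Open Scope ring_scope.
Variable R : realType.
Implicit Types (t s : ptree word).

(** Total on raw trees, with value 0 on ill-formed ones, so that sums of grafted trees need not
    carry proofs of well-formedness. *)
Definition bas_tree t : malg tritree R := oapp (bas R) 0 (insub t).

Lemma bas_treeE (t : tritree) : bas_tree (val t) = bas R t.
Proof. by rewrite /bas_tree valK. Qed.

(** The ladder of the only quasi-shuffle with an empty word; on the branch of a tree it rebuilds the
    tree. *)
Definition singles (u : seq letter) : ptree word :=
  foldr node_tree Leaf [seq [:: y] | y <- u].

Lemma singles_lefts t : tri_wf t -> singles (lefts t) = t.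
Proof.
elim/ptree_nested_ind: t => // w ts IH; rewrite tri_wf_node => /and3P[h2 _ hall].
case: (lastP ts) h2 hall IH => [|{}ts t] // _.
rewrite all_rcons /lefts /singles /= size_rcons map_rcons last_rcons => /andP[ht _] IH.
rewrite /node_tree /= !cats0 -cats1 take_size_cat //; congr (Node _ (_ ++ [:: _])).
suff : tri_wf t -> singles (lefts t) = t by apply.
by elim: ts IH => [|s ts IHts] [].
Qed.

Lemma singles_rights t : tri_wf t -> singles (rights t) = t.
Proof.
elim/ptree_nested_ind: t => // w ts IH; rewrite tri_wf_node => /and3P[h2 _ hall].
case: ts h2 hall IH => [|t ts] // _ /andP[ht _] [/(_ ht) IH _].
by rewrite /singles /= /node_tree /= !cats0; congr (Node _ (_ :: _)).
Qed.

Let prec := @at_prec R (tri_tridend R).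
Let succ := @at_succ R (tri_tridend R).
Let dot := @at_dot R (tri_tridend R).

Section Products.
Variables (w w' : word) (ts ts' : seq (ptree word)).
Let t := Node w ts.
Let s := Node w' ts'.
Variables (wft : tri_wf t) (wfs : tri_wf s).
Let k := size (last [::] (map rbranch ts)).
Let l := size (head [::] (map lbranch ts')).
Let bl := branch_letter t s.
Let u : seq letter := behead (lefts t).
Let v : seq letter := behead (rights s).
Let a : letter := (true, (w, take (size ts).-1 ts)).
Let b : letter := (false, (w', behead ts')).
Let t' : tritree := Sub t wft.
Let s' : tritree := Sub s wfs.

Let bl_left : map bl (iota 0 k.+1) = a :: u.
Proof. exact: (branch_letter_left t s). Qed.

Let bl_right : map bl (iota k.+1 l.+1) = b :: v.
Proof. exact: (branch_letter_right t s). Qed.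

Let H (L : seq (seq letter)) := bas_tree (foldr node_tree Leaf L).

Let tri_qshE P : tri_qsh R P t' s' = qsh_sum (k := k.+1) (l := l.+1) (P k.+1)
    (fun n q => H [seq [seq bl i | i <- fiber q m] | m <- enum 'I_n]).
Proof.
apply: eq_qsh_sum => n q; rewrite /H -graftE.
exact (esym (bas_treeE (tri_graft q))).
Qed.

Lemma bas_tree_prec :
  prec (bas_tree t) (bas_tree s) = \sum_(L <- qs u (b :: v)) H ([:: a] :: L).
Proof.
rewrite (bas_treeE t') (bas_treeE s').
apply (etrans (bilin_ext_bas _ _ _)); apply (etrans (bilin_bas _ _ _)).
apply (etrans (tri_qshE _)); exact (qsh_sum_prec H bl_left bl_right).
Qed.

Lemma bas_tree_succ :
  succ (bas_tree t) (bas_tree s) = \sum_(L <- qs (a :: u) v) H ([:: b] :: L).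
Proof.
rewrite (bas_treeE t') (bas_treeE s').
apply (etrans (bilin_ext_bas _ _ _)); apply (etrans (bilin_bas _ _ _)).
apply (etrans (tri_qshE _)); exact (qsh_sum_succ H bl_left bl_right).
Qed.

Lemma bas_tree_dot :
  dot (bas_tree t) (bas_tree s) = \sum_(L <- qs u v) H ([:: a; b] :: L).
Proof.
rewrite (bas_treeE t') (bas_treeE s').
apply (etrans (bilin_ext_bas _ _ _)); apply (etrans (bilin_bas _ _ _)).
apply (etrans (tri_qshE _)); exact (qsh_sum_dot H bl_left bl_right).
Qed.

Lemma bas_tree_aug : at_aug (tri_tridend R) (bas_tree t).
Proof. by rewrite (bas_treeE t'); apply: lspan_gen; exists t'. Qed.

End Products.

Let tree2 a t s : tri_wf (Node [:: a] [:: t; s]) = tri_wf t && tri_wf s.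
Proof. by rewrite tri_wf_node /= andbT. Qed.

(** In this product and the two that follow, one of the two branches consists of its root alone.
    Once the first fiber is fixed, one word is empty and a single quasi-shuffle remains. *)
Lemma prec_Y a s : tri_wf s -> s != Leaf ->
  prec (bas_tree (Node [:: a] [:: Leaf; Leaf])) (bas_tree s)
  = bas_tree (Node [:: a] [:: Leaf; s]).
Proof.
case: s => // w' ts' wfs _.
have wft : tri_wf (Node [:: a] [:: Leaf; Leaf]) by rewrite tree2.
apply (etrans (bas_tree_prec wft wfs)); rewrite qs0l big_seq1.
rewrite -[foldr _ _ _]/(node_tree [:: (true, ([:: a], [:: Leaf]))]
                          (singles (rights (Node w' ts')))).
by rewrite singles_rights.
Qed.

Lemma succ_Y t a s : tri_wf t -> tri_wf s -> t != Leaf ->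
  succ (bas_tree t) (bas_tree (Node [:: a] [:: Leaf; s]))
  = bas_tree (Node [:: a] [:: t; s]).
Proof.
case: t => // w ts wft wfs _.
have wfz : tri_wf (Node [:: a] [:: Leaf; s]) by rewrite tree2.
apply (etrans (bas_tree_succ wft wfz)); rewrite qs0r big_seq1.
rewrite -[foldr _ _ _]/(node_tree [:: (false, ([:: a], [:: s]))]
                          (singles (lefts (Node w ts)))).
by rewrite singles_lefts.
Qed.

Lemma dot_Y w ts a s : tri_wf (Node w ts) -> tri_wf s ->
  dot (bas_tree (Node w ts)) (bas_tree (Node [:: a] [:: Leaf; s]))
  = bas_tree (Node (rcons w a) (rcons ts s)).
Proof.
move=> wft wfs; have wfz : tri_wf (Node [:: a] [:: Leaf; s]) by rewrite tree2.
apply (etrans (bas_tree_dot wft wfz)); rewrite qs0r big_seq1.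
rewrite -[foldr _ _ _]/(node_tree
   [:: (true, (w, take (size ts).-1 ts)); (false, ([:: a], [:: s]))]
   (singles (map (pair true) (last [::] (map rbranch ts))))).
case: (lastP ts) wft {wfz} => [|{}ts t]; rewrite tri_wf_node // all_rcons.
move=> /and4P[_ _ wft _].
rewrite size_rcons map_rcons last_rcons singles_lefts //.
have -> : take (size ts).+1.-1 (rcons ts t) = ts by rewrite -cats1 take_size_cat.
by rewrite /node_tree /= !cats0 cats1 -[rcons (rcons ts t) s]cats1 cat_rcons.
Qed.

Lemma tri_morphism_unique (B : augTridend R) (f g : malg tritree R -> B) :
  @tridend_morphism R (tri_tridend R) B f -> @tridend_morphism R (tri_tridend R) B g ->
  (forall n, f (bas R (triY n)) = g (bas R (triY n))) -> f =1 g.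
Proof.
move=> hf hg hY; pose P t := f (bas_tree t) = g (bas_tree t).
have aug t : tri_wf t -> t != Leaf -> at_aug (tri_tridend R) (bas_tree t).
  by case: t => // w ts wft _; apply: bas_tree_aug.
have PY a : P (Node [:: a] [:: Leaf; Leaf]) by have := hY a; rewrite -!bas_treeE.
have wf2 t a s : tri_wf t -> tri_wf s -> tri_wf (Node [:: a] [:: t; s]).
  by rewrite tree2 => -> ->.
(* A leaf is the unit, and morphisms preserve products only on the augmentation part; leaf children
   are therefore treated apart, here and in [P2]. *)
have PZ a s : tri_wf s -> P s -> P (Node [:: a] [:: Leaf; s]).
  have [-> //|hs wfs Ps] := eqVneq s Leaf.
  have hY' : tri_wf (Node [:: a] [:: Leaf; Leaf]) by apply: wf2.
  by rewrite /P -(prec_Y a wfs hs) (tm_prec hf) ?(tm_prec hg) ?PY ?Ps //; apply: aug.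
have P2 t a s : tri_wf t -> tri_wf s -> P t -> P s -> P (Node [:: a] [:: t; s]).
  move=> wft wfs; have [-> _|ht Pt /(PZ a _ wfs) Pz] := eqVneq t Leaf; first exact: PZ.
  have hz : tri_wf (Node [:: a] [:: Leaf; s]) by apply: wf2.
  by rewrite /P -(succ_Y a wft wfs ht) (tm_succ hf) ?(tm_succ hg) ?Pt ?Pz //; apply: aug.
(* Induction on the number of angles of the root: the last angle and the last child are split off by
   [dot_Y], down to the binary case [P2]. *)
have Pnode w ts : tri_wf (Node w ts) -> (forall t, t \in ts -> P t) -> P (Node w ts).
  elim/last_ind: w ts => [|w a IH] ts; first by rewrite tri_wf_node; case: ts => [|? []].
  case: (lastP ts) => [|{}ts s]; rewrite tri_wf_node // size_rcons size_rcons eqSS all_rcons.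
  move=> /and4P[h2 /eqP hs wfs hts] Pts.
  have Ps : P s by apply: Pts; rewrite mem_rcons inE eqxx.
  have {}Pts t : t \in ts -> P t.
    by move=> ht; apply: Pts; rewrite mem_rcons inE ht orbT.
  case: w IH hs => [|b w] IH hs.
    case: ts h2 hs hts Pts {IH} => [|t [|? ?]] // _ _ /andP[wft _] Pts.
    by apply: P2 => //; apply: Pts; rewrite inE.
  have wfn : tri_wf (Node (b :: w) ts) by rewrite tri_wf_node hts hs eqxx.
  have hz : tri_wf (Node [:: a] [:: Leaf; s]) by apply: wf2.
  rewrite /P -dot_Y // (tm_dot hf) ?(tm_dot hg) ?(IH _ wfn Pts) ?(PZ a s wfs Ps) //;
    exact: aug.
have Pall t : tri_wf t -> P t.
  elim/ptree_nested_ind: t => [_|w ts IH wft].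
    have e : bas_tree Leaf = at_unit (tri_tridend R) by rewrite (bas_treeE tri_leaf).
    by rewrite /P e (tm_unit hf) (tm_unit hg).
  apply: Pnode => // t; have := wft; rewrite tri_wf_node => /and3P[_ _].
  elim: ts IH {wft} => //= s ts IHts [Ps /IHts h] /andP[wfs /h {}h].
  by rewrite inE => /predU1P[->|/h //]; apply: Ps.
have z0 (h : malg tritree R -> B) :
    (forall a x y, h (a *: x + y) = a *: h x + h y) -> h 0 = 0.
  by move=> hl; have := hl (-1) 0 0; rewrite scaler0 addr0 scaleN1r addNr.
have fg0 : f 0 = g 0 by rewrite (z0 _ (tm_linear hf)) (z0 _ (tm_linear hg)).
elim/malg_ind => [//|t|a x y hx hy]; last first.
  by rewrite (tm_linear hf) (tm_linear hg) hx hy.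
by rewrite -bas_treeE; apply: Pall; apply: (valP t).
Qed.

End Uniqueness.

(** * Truncated multiple zeta values *)

Section TruncatedZeta.
Local Open Scope ring_scope.
Variable R : realType.
Implicit Types (a b : posnat) (u v w : word).

(* The sum over N >= n_1 > ... > n_d >= 1. *)
Fixpoint tzeta (w : word) (N : nat) : R :=
  if w is a :: w' then \sum_(k < N) fseries R a k.+1 * tzeta w' k else 1.

Lemma fseries_ge0 a n : 0 <= fseries R a n.
Proof. by rewrite invr_ge0 exprn_ge0. Qed.

Lemma fseriesD a b n : fseries R (padd a b) n = fseries R a n * fseries R b n.
Proof. by rewrite /fseries exprD invfM. Qed.

Lemma tzetaS a w N :
  tzeta (a :: w) N.+1 = tzeta (a :: w) N + fseries R a N.+1 * tzeta w N.
Proof. by rewrite /= big_ord_recr. Qed.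

Lemma tzeta_ge0 w N : 0 <= tzeta w N.
Proof.
elim: w N => //= a w IH N; apply: sumr_ge0 => k _.
by rewrite mulr_ge0 ?fseries_ge0.
Qed.

Lemma tzeta_nondecreasing w : {homo tzeta w : m n / (m <= n)%N >-> m <= n}.
Proof.
case: w => [|a w]; first by [].
apply: homo_leq => [x|x y z|n]; [exact: lexx|exact: le_trans|].
by rewrite tzetaS lerDl mulr_ge0 ?fseries_ge0 ?tzeta_ge0.
Qed.

Definition ltzeta (N : nat) : Words R -> R^o := lin_ext (V := R^o) (tzeta^~ N).

HB.instance Definition _ N := GRing.Linear.copy (ltzeta N) (lin_ext _).

Lemma ltzeta_bas N w : ltzeta N (bas R w) = tzeta w N.
Proof. exact: lin_ext_bas. Qed.

Lemma ltzetaD N x y : ltzeta N (x + y) = ltzeta N x + ltzeta N y.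
Proof. exact: linearD. Qed.

Lemma ltzeta_wcons0 a x : ltzeta 0 (wcons a x) = 0.
Proof.
elim/malg_ind: x => [|w|k x y hx hy]; first by rewrite !linear0.
  by rewrite wcons_bas ltzeta_bas /= big_ord0.
by rewrite !linearP /= hx hy scaler0 addr0.
Qed.

Lemma ltzeta_wconsS N a x :
  ltzeta N.+1 (wcons a x) = ltzeta N (wcons a x) + fseries R a N.+1 * ltzeta N x.
Proof.
elim/malg_ind: x => [|w|k x y hx hy]; first by rewrite !linear0 mulr0 addr0.
  by rewrite wcons_bas !ltzeta_bas tzetaS.
by rewrite !linearP /= hx hy !scalerDr mulrDr addrACA scalerAr.
Qed.

Lemma ltzeta_wcons N a x :
  ltzeta N (wcons a x) = \sum_(k < N) fseries R a k.+1 * ltzeta k x.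
Proof.
elim: N => [|N IH]; first by rewrite ltzeta_wcons0 big_ord0.
by rewrite ltzeta_wconsS IH big_ord_recr.
Qed.

Lemma ltzeta_wcons3_0 a x b y c z : ltzeta 0 (wcons a x + wcons b y + wcons c z) = 0.
Proof.
apply (etrans (ltzetaD _ _ _)).
apply (etrans (congr2 +%R (ltzetaD _ _ _) (ltzeta_wcons0 _ _))).
apply (etrans (congr2 +%R (congr2 +%R (ltzeta_wcons0 _ _) (ltzeta_wcons0 _ _)) (erefl _))).
by rewrite !addr0.
Qed.

Lemma ltzeta_wcons3S N a x b y c z :
  ltzeta N.+1 (wcons a x + wcons b y + wcons c z)
  = ltzeta N (wcons a x + wcons b y + wcons c z)
    + (fseries R a N.+1 * ltzeta N x + fseries R b N.+1 * ltzeta N y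
       + fseries R c N.+1 * ltzeta N z).
Proof.
have AC (p q r p' q' r' : R) :
    p + p' + (q + q') + (r + r') = p + q + r + (p' + q' + r').
  by ring.
have split n : ltzeta n (wcons a x + wcons b y + wcons c z) =
    ltzeta n (wcons a x) + ltzeta n (wcons b y) + ltzeta n (wcons c z).
  exact (etrans (ltzetaD _ _ _) (congr2 +%R (ltzetaD _ _ _) (erefl _))).
apply (etrans (split _)); apply (etrans (congr2 +%R (congr2 +%R (ltzeta_wconsS _ _ _)
  (ltzeta_wconsS _ _ _)) (ltzeta_wconsS _ _ _))).
apply (fun e => etrans e (congr1 (+%R^~ _) (esym (split N)))).
exact (AC _ _ _ _ _ _).
Qed.

(** The induction is on N, not on the words. If U and V grow by dU and dV, the product grows by dU V
    + U dV + dU dV, and these are the increments of the three summands of the quasi-shuffle, the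
    diagonal one by [fseriesD]. *)
Lemma ltzeta_qshuffle N u v : ltzeta N (qshuffle R u v) = tzeta u N * tzeta v N.
Proof.
elim: N u v => [|N IH] u v;
  (case: u => [|a u]; first by rewrite qshuffle0l ltzeta_bas mul1r);
  (case: v => [|b v]; first by rewrite qshuffle0r ltzeta_bas mulr1).
  apply (etrans (congr1 (ltzeta 0) (qshuffle_cons R a u b v))).
  apply (etrans (ltzeta_wcons3_0 _ _ _ _ _ _)).
  by rewrite /tzeta !big_ord0 mulr0.
apply (etrans (congr1 (ltzeta N.+1) (qshuffle_cons R a u b v))).
apply (etrans (ltzeta_wcons3S N a _ b _ (padd a b) _)).
have e := etrans (congr1 (ltzeta N) (esym (qshuffle_cons R a u b v)))
  (IH (a :: u) (b :: v)).
apply (etrans (congr2 +%R e (congr2 +%R (congr2 +%R (congr1 ( *%R _) (IH _ _))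
  (congr1 ( *%R _) (IH _ _))) (congr1 ( *%R _) (IH _ _))))).
by rewrite !tzetaS fseriesD; ring.
Qed.

Lemma ltzeta_star N x y : ltzeta N (star x y) = ltzeta N x * ltzeta N y.
Proof.
elim/malg_ind: x => [|u|k x1 x2 h1 h2]; first by rewrite star0l !linear0 mul0r.
  elim/malg_ind: y => [|v|k y1 y2 h1 h2]; first by rewrite !linear0 mulr0.
    by rewrite star_bas ltzeta_qshuffle !ltzeta_bas.
  by rewrite !linearP /= h1 h2 mulrDr scalerAr.
by rewrite starP !linearP /= h1 h2 mulrDl scalerAl.
Qed.

(** With x = N + 1 and exponent 2, the difference of the two sides is 1 / (x (x + 1)^2); larger
    exponents only decrease the left side. *)
Lemma fseries_telescope a N : (1 < val a)%N ->
  fseries R a N.+2 + N.+2%:R^-1 <= N.+1%:R^-1.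
Proof.
move=> ha; have hN (n : nat) : 0 < n.+1%:R :> R by rewrite ltr0n.
have hle : fseries R a N.+2 <= (N.+2%:R ^+ 2)^-1.
  rewrite lef_pV2 ?posrE ?exprn_gt0 //.
  by rewrite ler_eXn2l ?ltr1n.
apply: le_trans (lerD hle (lexx _)) _.
have h1 : (0 : R) < N.+1%:R := hN _.
have e : N.+2%:R = N.+1%:R + 1 :> R by rewrite -natr1.
rewrite e; move: (N.+1%:R : R) h1 => x hx.
have hx1 : 0 < x + 1 by lra.
rewrite -subr_ge0.
have -> : x^-1 - (((x + 1) ^+ 2)^-1 + (x + 1)^-1) = (x * (x + 1) ^+ 2)^-1.
  by field; rewrite !gt_eqF.
by rewrite invr_ge0 mulr_ge0 ?exprn_ge0 // ltW.
Qed.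

(* Summing over n_1 > n_2 first costs at most 1 / n_2, which is absorbed by the
   exponent of n_2; this is the induction on the depth that gives convergence. *)
Lemma tzeta_absorb a b w N : (1 < val a)%N ->
  tzeta [:: a, b & w] N + N%:R^-1 * tzeta (b :: w) N <= tzeta (padd b pone :: w) N.
Proof.
(* The extra term on the left is an upper bound for the tail n_1 > N of the outer sum; adding it is
   what makes the induction on N close. *)
move=> ha; elim: N => [|N IH]; first by rewrite invr0 mul0r addr0 /= !big_ord0.
have e : fseries R (padd b pone) N.+1 = N.+1%:R^-1 * fseries R b N.+1.
  by rewrite fseriesD mulrC {1}/fseries expr1.
rewrite (tzetaS a) (tzetaS (padd b pone)) e.
(* The step from 0 to 1 is separate: the inverse of 0 is 0 by convention, so the telescoping starts
   at 1. *)
case: N IH e => [|N] IH e.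
  by rewrite tzetaS /= !big_ord0 !mulr0 !add0r mulrA.
have h := fseries_telescope N ha.
have hB := tzeta_ge0 (b :: w) N.+1.
have lin (T D B fa fb W n1 n2 : R) : T + n1 * B <= D -> (fa + n2) * B <= n1 * B ->
    T + fa * B + n2 * (B + fb * W) <= D + n2 * fb * W by move=> *; lra.
by rewrite (tzetaS b w N.+1); apply: lin IH (ler_wpM2r hB h).
Qed.

(** Each absorption shortens the word and leaves a first letter b + 1, which is again at least 2.
    For a one-letter word, the partial sum plus 1 / N is nonincreasing in N, and the constant 2
    bounds its value at N = 1. *)
Lemma tzeta_le2 w N : conv_word w -> tzeta w N <= 2.
Proof.
case: w => [|a w]; first by rewrite /= ler1n.
move=> ha; have {}ha : (1 < val a)%N by rewrite ltn_neqAle eq_sym (valP a) andbT.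
elim: w a ha => [|b w IH] a ha.
  apply: le_trans (tzeta_nondecreasing _ (leqnSn N)) _.
  suff : tzeta [:: a] N.+1 + N.+1%:R^-1 <= 2.
    by apply: le_trans; rewrite lerDl invr_ge0.
  elim: N => [|N IH]; first by rewrite /= big_ord1 /fseries expr1n invr1 mulr1.
  rewrite tzetaS mulr1 -addrA; apply: le_trans IH.
  by rewrite lerD2l fseries_telescope.
apply: le_trans (IH (padd b pone) _); last by rewrite /= addn1 ltnS (valP b).
apply: le_trans (tzeta_absorb b w N ha).
by rewrite lerDl mulr_ge0 ?invr_ge0 ?tzeta_ge0.
Qed.

End TruncatedZeta.

(** * Truncated sums over trees *)

Section TruncatedTrees.
Local Open Scope ring_scope.
Variable R : realType.
Implicit Types (t : ptree posnat) (ts : seq (ptree posnat)).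
Implicit Types (V : seq (seq nat * posnat)).

Fixpoint ttree t (N : nat) : R :=
  if t is Node n ts
  then \sum_(k < N) fseries R n k.+1 * foldr (fun f y => f (val k) * y) 1 (map ttree ts)
  else 1.

Lemma ltzeta_flat_forest ts (k : nat) :
  foldr (fun t Q => (forall N, ltzeta N (flat_ptree R t) = ttree t N) /\ Q) True ts ->
  ltzeta k (foldr (@star R) (bas R [::]) (map (flat_ptree R) ts))
  = foldr (fun f y => f k * y) 1 (map ttree ts).
Proof.
elim: ts => [_|t ts IH [IHt /IH h]]; first exact: ltzeta_bas.
exact (etrans (ltzeta_star _ _ _) (congr2 *%R (IHt _) h)).
Qed.

(** Once the root has value k + 1, the subtrees are independent with values at most k, so their sums
    multiply; [ltzeta_star] gives the same product for their flattenings. *)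
Lemma ltzeta_flat t N : ltzeta N (flat_ptree R t) = ttree t N.
Proof.
elim/ptree_nested_ind: t N => [|n ts IH] N; first exact: ltzeta_bas.
refine (etrans (ltzeta_wcons N n _) _).
refine (eq_bigr _ (fun k _ => congr1 ( *%R _) (ltzeta_flat_forest _ IH))).
Qed.

(* The valuations of the vertices by positive integers at most N, decreasing along
   the branches, listed in the order of vertices t. *)
Fixpoint tree_enum t (N : nat) : seq (seq nat) :=
  if t is Node n ts
  then [seq k.+1 :: x | k <- iota 0 N,
          x <- foldr (fun e acc => [seq y ++ z | y <- e k, z <- acc]) [:: [::]]
                 (map tree_enum ts)]
  else [:: [::]].

Definition forest_enum ts (k : nat) : seq (seq nat) :=
  foldr (fun e acc => [seq y ++ z | y <- e k, z <- acc]) [:: [::]] (map tree_enum ts).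

Lemma tree_enum_node n ts N :
  tree_enum (Node n ts) N = [seq k.+1 :: x | k <- iota 0 N, x <- forest_enum ts k].
Proof. by []. Qed.

Lemma forest_enum_cons t ts k :
  forest_enum (t :: ts) k = [seq y ++ z | y <- tree_enum t k, z <- forest_enum ts k].
Proof. by []. Qed.

(** The index i of the first child is free, to allow induction on the forest. *)
Definition forest_vertices (i : nat) ts : seq (seq nat * posnat) :=
  flatten [seq [seq (p.1 :: v.1, v.2) | v <- p.2]
          | p <- zip (iota i (size ts)) (map vertices ts)].

Lemma vertices_node n ts : vertices (Node n ts) = ([::], n) :: forest_vertices 0 ts.
Proof. by []. Qed.

Lemma forest_vertices_cons i t ts : forest_vertices i (t :: ts) =
  [seq (i :: v.1, v.2) | v <- vertices t] ++ forest_vertices i.+1 ts.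
Proof. by []. Qed.

Lemma forest_vertices_addr i ts v : v \in forest_vertices i ts ->
  exists2 j, (i <= j)%N & exists a, v.1 = j :: a.
Proof.
elim: ts i => [|t ts IH] i; first by rewrite inE.
rewrite forest_vertices_cons mem_cat => /orP[/mapP[u _ ->]|/IH[j hj h]].
  by exists i => //; exists u.1.
by exists j => //; apply: ltnW.
Qed.

Lemma uniq_vertices t : uniq (vertices t).
Proof.
elim/ptree_nested_ind: t => // n ts IH; rewrite vertices_node cons_uniq.
apply/andP; split; first by apply/negP => /forest_vertices_addr[j _ [a]].
suff h i : uniq (forest_vertices i ts) by apply: h.
elim: ts i IH => // t ts IHts i [ut /IHts h].
rewrite forest_vertices_cons cat_uniq h andbT map_inj_uniq ?ut /=.
  apply/hasPn => v /forest_vertices_addr[j hj [a ev]]; apply/negP => /mapP[u _ eu].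
  by move: ev hj; rewrite eu /= => -[-> _]; rewrite ltnn.
by move=> [a1 d1] [a2 d2] [-> ->].
Qed.

Definition strict_prefix (w v : seq nat * posnat) : bool := prefix w.1 v.1 && (w != v).

Definition decreasing (z : seq ((seq nat * posnat) * nat)) : bool :=
  all (fun p => all (fun q => strict_prefix p.1 q.1 ==> (q.2 < p.2)%N) z) z.

Definition valuation V (N : nat) (x : seq nat) : bool :=
  [&& size x == size V, decreasing (zip V x) & all (fun k => 0 < k <= N)%N x].

Lemma decreasing_cat z1 z2 :
  (forall p q, p \in z1 -> q \in z2 ->
     ~~ strict_prefix p.1 q.1 && ~~ strict_prefix q.1 p.1) ->
  decreasing (z1 ++ z2) = decreasing z1 && decreasing z2.
Proof.
move=> h; rewrite /decreasing all_cat; congr andb; apply: eq_in_all => p hp.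
  rewrite all_cat andb_idr // => _; apply/allP => q hq.
  by have /andP[/negPf ->] := h _ _ hp hq.
rewrite all_cat andb_idl // => _; apply/allP => q hq.
by have /andP[_ /negPf ->] := h _ _ hq hp.
Qed.

Lemma zip_fst V (x : seq nat) p : p \in zip V x -> p.1 \in V.
Proof.
elim: V x => [|v V IH] [|k x] //=; rewrite !inE.
by move=> /predU1P[->|/IH ->]; rewrite ?eqxx ?orbT.
Qed.

Lemma decreasing_shift i V x :
  decreasing (zip [seq (i :: v.1, v.2) | v <- V] x) = decreasing (zip V x).
Proof.
have -> : zip [seq (i :: v.1, v.2) | v <- V] x =
    [seq ((i :: p.1.1, p.1.2), p.2) | p <- zip V x].
  by elim: V x => [|v V IH] [|k x] //=; rewrite IH.
rewrite /decreasing all_map; apply: eq_all => p /=.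
rewrite all_map; apply: eq_all => q /=.
rewrite /strict_prefix prefix_cons eqxx /=; congr (_ && ~~ _ ==> _).
by rewrite !xpair_eqE eqseq_cons eqxx.
Qed.

(** Addresses in different subtrees differ in their first entry, so no vertex of one is an ancestor
    of a vertex of the other. *)
Lemma valuation_forest_cons i t ts N y z : size y = size (vertices t) ->
  valuation (forest_vertices i (t :: ts)) N (y ++ z) =
  valuation (vertices t) N y && valuation (forest_vertices i.+1 ts) N z.
Proof.
move=> sy; rewrite /valuation forest_vertices_cons zip_cat ?size_map // decreasing_cat.
  rewrite decreasing_shift all_cat !size_cat size_map sy eqn_add2l eqxx /=.
  by case: eqP; case: decreasing; case: decreasing; case: all; case: all.
move=> p q /zip_fst /mapP[u _ ->] /zip_fst /forest_vertices_addr[j hj [a e]].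
by rewrite /strict_prefix /= e !prefix_cons [j == i]eq_sym ltn_eqF.
Qed.

(** The root is a strict ancestor of all other vertices, so its value k replaces their bound N by k
    - 1. *)
Lemma valuation_node n ts N k x : valuation (vertices (Node n ts)) N (k :: x) =
  [&& 0 < k, k <= N & valuation (forest_vertices 0 ts) k.-1 x]%N.
Proof.
rewrite vertices_node /valuation /= eqSS.
set V := forest_vertices 0 ts; set z := zip V x.
have -> : decreasing ((([::], n), k) :: z) = all (fun q => q.2 < k)%N z && decreasing z.
  rewrite {1}/decreasing /= /strict_prefix /= eqxx /=.
  congr andb.
    apply: eq_in_all => q /zip_fst /forest_vertices_addr[j _ [a e]].
    by rewrite -[_ == q.1]negbK; case: (q.1) e => ? ? /= ->.
  apply: eq_in_all => q /zip_fst /forest_vertices_addr[j _ [a e]].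
  by rewrite {1}e.
case: eqP => [sz|_] /=; last by rewrite !andbF.
have -> : all (fun q => q.2 < k)%N z = all (fun m => m < k)%N x.
  rewrite -[in RHS](unzip2_zip (s := V) (t := x)) ?sz // all_map.
  by apply: eq_all.
case: k => [|k] /=; first by rewrite !andbF.
case: (leqP k.+1 N) => hk; rewrite ?andbF //=.
have <- : all (fun m => m < k.+1)%N x && all (fun m => 0 < m <= N)%N x
          = all (fun m => 0 < m <= k)%N x.
  rewrite -all_predI; apply: eq_all => m /=; rewrite ltnS.
  case: (leqP m k) => hm; rewrite ?andbF //.
  by rewrite (leq_trans hm (ltnW hk)) andbT.
by case: decreasing; rewrite ?andbT ?andbF.
Qed.

Lemma mem_tree_enum t N x : (x \in tree_enum t N) = valuation (vertices t) N x.
Proof.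
elim/ptree_nested_ind: t N x => [|n ts IH] N x.
  by rewrite inE /valuation; case: x.
have forest i k y : (y \in forest_enum ts k) = valuation (forest_vertices i ts) k y.
  elim: ts i y IH => [|t ts IHts] i y; first by rewrite inE /valuation; case: y.
  move=> [IHt /IHts {}IHts]; rewrite forest_enum_cons.
  apply/allpairsPdep/idP => [[y1 [y2 [h1 h2 ->]]]|hy].
    rewrite valuation_forest_cons; first by rewrite -IHt h1 -IHts h2.
    by move: h1; rewrite IHt => /and3P[/eqP].
  (* The vertices of the first subtree are listed first, so a valuation of the forest is cut after m
     entries. *)
  pose m := size (vertices t).
  exists (take m y), (drop m y).
  have sy : size (take m y) = m.
    move: hy => /and3P[/eqP hy _ _]; rewrite size_take hy forest_vertices_cons.
    rewrite size_cat size_map -/m; case: ltnP => //.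
    by move=> hm; apply/eqP; rewrite eqn_leq hm leq_addr.
  move: hy; rewrite -[y in valuation _ _ y](cat_take_drop m) valuation_forest_cons //.
  by rewrite -IHt -(IHts i.+1) cat_take_drop => /andP[].
rewrite tree_enum_node; case: x => [|k x].
  by apply/negbTE/negP => /allpairsPdep[? [? []]].
rewrite valuation_node.
apply/allpairsPdep/and3P => [[k' [y [hk hy [-> ->]]]]|[k0 kN hx]].
  by split => //=; [rewrite mem_iota in hk | rewrite -forest].
exists k.-1, x; split; last by rewrite prednK.
  by rewrite mem_iota /= add0n prednK.
by rewrite (forest 0%N).
Qed.

(** All valuations of a given tree have the same length, so a concatenation determines its two
    parts. *)
Lemma uniq_tree_enum t N : uniq (tree_enum t N).
Proof.
elim/ptree_nested_ind: t N => // n ts IH N.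
have forest k : uniq (forest_enum ts k).
  elim: ts IH => [|t ts IHts] //= [ut /IHts us].
  rewrite allpairs_uniq // => -[y1 z1] [y2 z2] /=.
  move=> /allpairsPdep[? [? [h1 _ [-> ->]]]] /allpairsPdep[? [? [h2 _ [-> ->]]]] /eqP.
  move: h1 h2; rewrite !mem_tree_enum => /and3P[/eqP s1 _ _] /and3P[/eqP s2 _ _].
  by rewrite eqseq_cat ?s1 // => /andP[/eqP -> /eqP ->].
rewrite tree_enum_node; apply: allpairs_uniq_dep; first exact: iota_uniq.
  by move=> k _; apply: forest.
by move=> [k x] [l y] _ _ /= [-> ->].
Qed.

Lemma tree_enum_mono t x M N :
  (M <= N)%N -> x \in tree_enum t M -> x \in tree_enum t N.
Proof.
move=> hMN; rewrite !mem_tree_enum => /and3P[h1 h2 h3].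
apply/and3P; split => //; apply: sub_all h3 => k /andP[-> hk].
exact: leq_trans hk hMN.
Qed.

Definition monomial (w : word) (x : seq nat) : R :=
  \prod_(p <- zip w x) fseries R p.1 p.2.

Lemma monomial_ge0 w x : 0 <= monomial w x.
Proof. by apply: prodr_ge0 => p _; apply: fseries_ge0. Qed.

Lemma monomial_cat u v x y : size x = size u ->
  monomial (u ++ v) (x ++ y) = monomial u x * monomial v y.
Proof. by move=> h; rewrite /monomial zip_cat // big_cat. Qed.

Lemma monomial_cons a w k x : monomial (a :: w) (k :: x) = fseries R a k * monomial w x.
Proof. by rewrite /monomial /= big_cons. Qed.

Lemma sum_tree_enum t N :
  \sum_(x <- tree_enum t N) monomial (map snd (vertices t)) x = ttree t N.
Proof.
elim/ptree_nested_ind: t N => [|n ts IH] N; first by rewrite big_seq1 /monomial big_nil.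
have forest i k :
    \sum_(x <- forest_enum ts k) monomial (map snd (forest_vertices i ts)) x
    = foldr (fun f y => f k * y) 1 (map ttree ts).
  elim: ts i IH => [|t ts IHts] i; first by rewrite big_seq1 /monomial big_nil.
  move=> [IHt /IHts {}IHts]; rewrite forest_enum_cons big_allpairs_dep /=.
  rewrite -IHt -(IHts i.+1) mulr_suml big_seq [RHS]big_seq; apply: eq_bigr => y hy.
  rewrite mulr_sumr; apply: eq_bigr => z _.
  rewrite forest_vertices_cons map_cat -map_comp monomial_cat //.
  by move: hy; rewrite mem_tree_enum size_map => /and3P[/eqP].
rewrite tree_enum_node big_allpairs_dep /=.
rewrite -[N in iota 0 N]subn0 -/(index_iota 0 N) big_mkord; apply: eq_bigr => k _.
rewrite -(forest 0%N) mulr_sumr; apply: eq_bigr => x _.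
exact: monomial_cons.
Qed.

End TruncatedTrees.

(** * Convergence *)

Section Sums.
Local Open Scope ring_scope.
Variable R : realType.

(** The index set is encoded by h as lists of integers and exhausted by the increasing finite sets e
    N; with nonnegative terms, the unordered sum is the supremum of the sums over them. It serves
    both chains and tree valuations. *)
Lemma esum_exhaustion (T : choiceType) (D : set T) (h : T -> seq nat)
    (e : nat -> seq (seq nat)) (F : seq nat -> R) :
  set_inj D h -> (forall N, uniq (e N)) ->
  (forall x M N, (M <= N)%N -> x \in e M -> x \in e N) ->
  (forall N x, x \in e N -> exists2 t, D t & h t = x) ->
  (forall t, D t -> exists N, h t \in e N) -> (forall x, 0 <= F x) ->
  (\esum_(t in D) (F (h t))%:E
   = ereal_sup (range (fun N => (\sum_(x <- e N) F x)%:E)))%E.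
Proof.
move=> h_inj e_uniq e_mono e_sub e_sup F0.
have <- : (\esum_(x in h @` D) (F x)%:E = \esum_(t in D) (F (h t))%:E)%E.
  exact: (esum_image D h (fun x => (F x)%:E)).
apply/eqP; rewrite eq_le; apply/andP; split; apply: ge_ereal_sup => z /=.
  move=> [X [/finite_seqP[s ->] sD] <-{z}].
  (* A finite set of indices lies in a single e N, for N the maximum of the levels at which its
     elements appear. *)
  have [N hN] : exists N, {subset s <= e N}.
    elim: s sD => [|x s IH] sD; first by exists 0%N.
    have [|M hM] := IH; first by move=> y hy; apply: sD; rewrite /= inE hy orbT.
    have [t Dt hx] : (h @` D) x by apply: sD; rewrite /= inE eqxx.
    have [K hK] := e_sup _ Dt; exists (maxn M K) => y; rewrite inE => /predU1P[->|/hM].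
      by apply: e_mono (leq_maxr _ _) _; rewrite -hx.
    by apply: e_mono; apply: leq_maxl.
  apply: ereal_sup_ge; exists (\sum_(x <- e N) F x)%:E; first by exists N.
  rewrite -sumEFin [leRHS](fsbig_seq _ _ (e_uniq N)); apply: lee_fsum_nneg_subset.
  - by apply/finite_seqP; exists s.
  - by apply/finite_seqP; exists (e N).
  - by move=> x; rewrite !inE /= => /hN.
  - by move=> x _; rewrite lee_fin.
move=> [N _ <-{z}]; rewrite -sumEFin (fsbig_seq _ _ (e_uniq N)).
apply: ereal_sup_ubound.
exists [set` e N] => //; split; first by apply/finite_seqP; exists (e N).
by move=> x /= /e_sub[t Dt <-]; exists t.
Qed.

(** Turns a word into a unary tree, whose valuations are the chains: the enumeration of [ptree] then
    handles words and trees together. *)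
Definition ladder_tree (w : word) : ptree posnat :=
  foldr (fun a t => Node a [:: t]) Leaf w.

Lemma forest_enum1 t k : forest_enum [:: t] k = tree_enum t k.
Proof.
rewrite forest_enum_cons /=; elim: (tree_enum t k) => //= x s ->.
by rewrite cats0.
Qed.

Lemma decorations_ladder w : map snd (vertices (ladder_tree w)) = w.
Proof.
elim: w => //= a w {2}<-; rewrite cats0 -map_comp.
by congr (_ :: _); apply: eq_map.
Qed.

Lemma ttree_ladder w N : ttree R (ladder_tree w) N = tzeta R w N.
Proof.
elim: w N => //= a w IH N; apply: eq_bigr => k _.
by rewrite mulr1 IH.
Qed.

Lemma mem_ladder_enum w N x : (x \in tree_enum (ladder_tree w) N) =
  [&& size x == size w, sorted gtn x & all (fun k => 0 < k <= N)%N x].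
Proof.
elim: w N x => [|a w IH] N x; first by rewrite inE; case: x.
rewrite [ladder_tree _]/= tree_enum_node; case: x => [|k x].
  by apply/negbTE/negP => /allpairsPdep[? [? []]].
apply/allpairsPdep/idP => [[k' [y [hk hy [-> ->]]]]|].
  move: hk hy; rewrite mem_iota forest_enum1 IH /= => hk /and3P[/eqP -> hs ha].
  rewrite eqxx /= hk path_sortedE ?hs ?andbT; last first.
    by move=> ? ? ? /= h1 h2; apply: ltn_trans h2 h1.
  apply/andP; split; first by apply: sub_all ha => m /andP[_].
  by apply: sub_all ha => m /andP[-> hm]; apply: leq_trans hm (ltnW hk).
rewrite /= eqSS path_sortedE; last by move=> ? ? ? /= h1 h2; apply: ltn_trans h2 h1.
move=> /and4P[/eqP sx /andP[hk hs] /andP[k0 kN] ha].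
exists k.-1, x; split; last by rewrite prednK.
  by rewrite mem_iota /= add0n prednK.
rewrite forest_enum1 IH sx eqxx hs /=; apply/allP => m hm.
have /andP[-> _] := allP ha _ hm; have := allP hk _ hm.
by rewrite /= -{1}(prednK k0) ltnS.
Qed.

Lemma fseries_prod_monomial w (n : (size w).-tuple nat) :
  fseries_prod R w n = monomial R w n.
Proof.
rewrite /fseries_prod /monomial (big_nth (pone, 0%N)) big_mkord.
have -> : size (zip w n) = size w by rewrite size_zip size_tuple minnn.
apply: eq_bigr => i _; rewrite nth_zip ?size_tuple //=.
by rewrite !(tnth_nth pone) (tnth_nth 0%N).
Qed.

(** The sum of a list of integers serves as a truncation level that no entry exceeds. *)
Lemma leq_sumn (s : seq nat) k : k \in s -> (k <= sumn s)%N.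
Proof.
elim: s => //= x s IH; rewrite inE => /predU1P[->|/IH h]; first exact: leq_addr.
exact: leq_trans h (leq_addl _ _).
Qed.

Lemma esum_chains w :
  (\esum_(n in chains (size w)) (fseries_prod R w n)%:E
   = ereal_sup (range (EFin \o tzeta R w)))%E.
Proof.
transitivity (\esum_(n in chains (size w)) (monomial R w (val n))%:E)%E.
  by apply: eq_esum => n _; rewrite fseries_prod_monomial.
rewrite (esum_exhaustion (h := val) (e := tree_enum (ladder_tree w))).
- congr (ereal_sup _); apply: eq_imagel => N _ /=.
  by rewrite -ttree_ladder -sum_tree_enum decorations_ladder.
- by move=> ? ? _ _; apply: val_inj.
- exact: uniq_tree_enum.
- by move=> x M N; apply: tree_enum_mono.
- move=> N x; rewrite mem_ladder_enum => /and3P[sx hs ha].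
  exists (Tuple sx) => //; rewrite /chains /= hs /=.
  by apply: sub_all ha => k /andP[].
- move=> n /andP[hs ha]; exists (sumn n); rewrite mem_ladder_enum size_tuple eqxx hs /=.
  by apply/allP => k hk; rewrite (allP ha _ hk) leq_sumn.
- exact: monomial_ge0.
Qed.

(** * Sums over the valuations of a tree *)

Section TreeSums.
Variable t : vtree.
Let vs : seq (nu t) := seq_sub_enum (vertices (val t)).
Let values (k : {ffun nu t -> posnat}) : seq nat := [seq val (k v) | v <- vs].

Let vsE : map val vs = vertices (val t).
Proof. exact/val_seq_sub_enum/uniq_vertices. Qed.

Let values_inj : injective values.
Proof.
move=> k l /eq_in_map h; apply/ffunP => v; apply/val_inj/h.
exact: mem_seq_sub_enum.
Qed.

Let decreasing_values k :
  decreasing (zip (vertices (val t)) (values k)) <-> tree_dom t k.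
Proof.
rewrite -vsE zip_map /decreasing all_map; split=> [/allP h v w hwv|h].
  have := h w (mem_seq_sub_enum w); rewrite /= all_map.
  move=> /allP /(_ v (mem_seq_sub_enum v)) /= /implyP.
  exact.
apply/allP => w _; rewrite /= all_map; apply/allP => v _ /=; apply/implyP => hwv.
exact: h.
Qed.

Let tree_termE k : tree_term R t k = monomial R (map snd (vertices (val t))) (values k).
Proof.
rewrite /monomial -vsE -map_comp zip_map big_map /tree_term.
apply: perm_big; apply: uniq_perm; rewrite ?index_enum_uniq ?undup_uniq // => v.
by rewrite mem_index_enum mem_seq_sub_enum.
Qed.

Lemma esum_tree_dom :
  (\esum_(k in tree_dom t) (tree_term R t k)%:E
   = ereal_sup (range (EFin \o ttree R (val t))))%E.
Proof.
transitivity (\esum_(k in tree_dom t)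
    (monomial R (map snd (vertices (val t))) (values k))%:E)%E.
  by apply: eq_esum => n _; rewrite tree_termE.
have pos k : all (fun m => 0 < m <= sumn (values k))%N (values k).
  apply/allP => m hm; rewrite leq_sumn // andbT.
  by have /mapP[v _ ->] := hm; apply: valP.
rewrite (esum_exhaustion (h := values) (e := tree_enum (val t))).
- congr (ereal_sup _); apply: eq_imagel => N _ /=.
  by rewrite -sum_tree_enum.
- by move=> ? ? _ _; apply: values_inj.
- exact: uniq_tree_enum.
- by move=> x M N; apply: tree_enum_mono.
- move=> N x; rewrite mem_tree_enum => /and3P[/eqP sx hd ha].
  (* The valuation is read off from the list x; its entries are positive, so the default [pone] is
     never returned. *)
  pose k := [ffun v => insubd pone (nth 0%N x (index v vs))] : {ffun nu t -> posnat}.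
  have svs : size vs = size x by rewrite sx -vsE size_map.
  have hk : values k = x.
    apply: (@eq_from_nth _ 0%N); first by rewrite size_map.
    move=> i; rewrite size_map => hi.
    have v0 : nu t by case: (vs) hi => [|v].
    rewrite (nth_map v0) // ffunE index_uniq ?undup_uniq // insubdK //.
    by have /andP[] := allP ha _ (mem_nth 0%N (etrans (esym (congr1 _ svs)) hi)).
  by exists k => //; apply/decreasing_values; rewrite hk.
- move=> k hk; exists (sumn (values k)); rewrite mem_tree_enum /valuation pos andbT.
  by rewrite -[in size (vertices _)]vsE !size_map eqxx /=; apply/decreasing_values.
- exact: monomial_ge0.
Qed.

End TreeSums.

(** Provides both halves of each convergence argument: the unordered sum is finite, and [fine] of it
    is the limit of the truncations. *)
Lemma bounded_sup (u : nat -> R) M : {homo u : m n / (m <= n)%N >-> m <= n} ->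
  (forall N, u N <= M) ->
  [/\ (ereal_sup (range (EFin \o u)) < +oo)%E
    & u N @[N --> \oo] --> fine (ereal_sup (range (EFin \o u)))].
Proof.
move=> hu hM.
have ub : has_ubound (range u) by exists M => _ [N _ <-].
have -> : range (EFin \o u) = EFin @` range u by rewrite image_comp.
rewrite ereal_sup_EFin //; last by exists (u 0%N); exists 0%N.
by split; [exact: ltry | exact: nondecreasing_cvgn].
Qed.

Lemma conv_wordsP x : Words_conv R x -> forall w, w \in msupp x -> conv_word w.
Proof. by move=> /lspan_basP h w /h. Qed.

(** A bound uniform in N, since [tzeta_le2] is uniform in both N and the word. *)
Lemma ltzeta_le x N : Words_conv R x ->
  ltzeta N x <= \sum_(w <- msupp x) `|mcoeff w x| * 2.
Proof.
move=> /conv_wordsP hx; rewrite /ltzeta /lin_ext big_seq [leRHS]big_seq.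
apply: ler_sum => w hw; apply: le_trans (ler_norm _) _.
by rewrite normrM ler_wpM2l // ger0_norm ?tzeta_ge0 // tzeta_le2 // hx.
Qed.

Lemma cvg_ltzeta x : Words_conv R x -> ltzeta N x @[N --> \oo] --> zeta R x.
Proof.
move=> /conv_wordsP hx; rewrite /ltzeta /zeta /lin_ext.
under eq_cvg => N do rewrite big_seq.
rewrite big_seq; apply: cvg_big => [|w /hx hw]; first exact: add_continuous.
apply: cvgZ; first exact: cvg_cst.
rewrite /zeta_word esum_chains.
by case: (bounded_sup (@tzeta_nondecreasing R w) (fun N => tzeta_le2 R N hw)).
Qed.

End Sums.

(** * The diagram *)

Section Diagram.
Local Open Scope ring_scope.
Variable R : realType.

Lemma tridend_morphism_comp (A B C : augTridend R) (f : A -> B) (g : B -> C) :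
  tridend_morphism f -> tridend_morphism g -> tridend_morphism (g \o f).
Proof.
move=> hf hg; split => /=.
- by move=> a x y; rewrite (tm_linear hf) (tm_linear hg).
- by rewrite (tm_unit hf) (tm_unit hg).
- by move=> x /(tm_aug hf) /(tm_aug hg).
- by move=> x y hx hy; rewrite (tm_prec hf) // (tm_prec hg) //; apply: (tm_aug hf).
- by move=> x y hx hy; rewrite (tm_succ hf) // (tm_succ hg) //; apply: (tm_aug hf).
- by move=> x y hx hy; rewrite (tm_dot hf) // (tm_dot hg) //; apply: (tm_aug hf).
Qed.

Lemma flat_iota_morphism :
  @tridend_morphism R (tri_tridend R) (words_tridend R) (flat R \o iota_map R).
Proof.
have -> : flat R \o iota_map R = lin_ext (fun t : tritree => flat_angle R (val t)).
  by apply/funext => x; apply: flat_iotaE.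
exact: flat_morphism.
Qed.

Lemma flat_iota_Y n : flat R (iota_map R (bas R (triY n))) = bas R [:: n].
Proof.
rewrite flat_iotaE lin_ext_bas flat_angle_node.
by rewrite /flat_forest /= !star1l wcons_bas.
Qed.

(** [flat R \o iota_map R] satisfies the specification of [Psi], which rules out the default value
    of [xget]; uniqueness identifies whatever morphism was chosen with it. *)
Lemma PsiE : Psi R =1 flat R \o iota_map R.
Proof.
rewrite /Psi; case: xgetP => [f _ [hf hY]|h].
  apply: (tri_morphism_unique hf flat_iota_morphism) => n.
  by rewrite hY; apply/esym/flat_iota_Y.
case: (h (flat R \o iota_map R)); split; first exact: flat_iota_morphism.
exact: flat_iota_Y.
Qed.

Lemma zetaTriE : zetaTri R =1 zetaFS R \o (flat R \o iota_map R).
Proof.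
have hm := tridend_morphism_comp flat_iota_morphism (zetaFS_morphism R).
have hY n : (zetaFS R \o (flat R \o iota_map R)) (bas R (triY n)) = fs_gen R [:: n].
  by rewrite /= flat_iota_Y; apply: lin_ext_bas.
rewrite /zetaTri; case: xgetP => [f _ [hf hfY]|h].
  by apply: (tri_morphism_unique hf hm) => n; rewrite hfY hY.
by case: (h (zetaFS R \o (flat R \o iota_map R))).
Qed.

Lemma lin_ext_lspan (K : choiceType) (V : lmodType R) (P : pred K)
    (U : set V) (f : K -> V) x :
  Defs.subspace U -> (forall k, P k -> U (f k)) ->
  lspan [set bas R k | k in [set k | P k]] x -> U (lin_ext f x).
Proof.
move=> hU hf /lspan_basP hx; apply: subspace_lin_ext => // k /hx; exact: hf.
Qed.

(** The sum of a word is at least its length, so a sum equal to 1 forces a single letter, equal to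
    1. *)
Lemma psum_neq1 (w : word) : (0 < size w)%N -> w != [:: pone] -> psum w != pone.
Proof.
move=> w0; apply: contraNneq => hw; have := psum_ge w; rewrite hw /=.
by case: w w0 hw => [|a [|b w]] //= _ ->.
Qed.

Lemma iota_conv : set_fun (Tridend_conv R) (Tree_conv R) (iota_map R).
Proof.
move=> x hx; apply: lin_ext_lspan hx; first exact: lspan_subspace.
move=> -[[|w ts] wf] ht; apply: lspan_gen; eexists; [|reflexivity| |reflexivity] => //=.
apply: psum_neq1 ht; move: wf; rewrite tri_wf_node => /and3P[h2 /eqP hs _].
by rewrite -ltnS -hs.
Qed.

Lemma wcons_conv a x : a != pone -> Words_conv R (wcons a x).
Proof.
move=> ha; apply: subspace_lin_ext; first exact: lspan_subspace.
by move=> w _; apply: lspan_gen; exists (a :: w).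
Qed.

Lemma flat_ptree_conv (t : vtree) : conv_vtree t -> Words_conv R (flat_ptree R (val t)).
Proof.
case: t => -[|n ts] wf; last exact: wcons_conv.
by move=> _; apply: lspan_gen; exists [::].
Qed.

Lemma flat_conv : set_fun (Tree_conv R) (Words_conv R) (flat R).
Proof.
move=> x hx; apply: lin_ext_lspan hx; first exact: lspan_subspace.
exact: flat_ptree_conv.
Qed.

Lemma zetaFS_conv : set_fun (Words_conv R) (S_conv R) (zetaFS R).
Proof.
move=> x hx; apply: lin_ext_lspan hx; first exact: lspan_subspace.
by move=> w hw; apply: lspan_gen; exists w.
Qed.

Lemma summable_words w : conv_word w ->
  summable (chains (size w)) (fun n => (fseries_prod R w n)%:E).
Proof.
move=> hw; rewrite /summable.
under eq_esum => n _.
  rewrite gee0_abs; last by rewrite lee_fin fseries_prod_monomial monomial_ge0.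
  over.
rewrite esum_chains.
by case: (bounded_sup (@tzeta_nondecreasing R w) (fun N => tzeta_le2 R N hw)).
Qed.

Lemma ttree_nondecreasing t : {homo ttree R t : m n / (m <= n)%N >-> m <= n}.
Proof.
have ge0 u N : 0 <= ttree R u N.
  by rewrite -sum_tree_enum; apply: sumr_ge0 => x _; apply: monomial_ge0.
case: t => [|n ts]; first by [].
apply: homo_leq => [x|x y z|N]; [exact: lexx|exact: le_trans|].
rewrite /= big_ord_recr lerDl mulr_ge0 ?fseries_ge0 //.
by elim: ts => //= t ts IH; rewrite mulr_ge0.
Qed.

(** Convergence on trees is inherited from words: the truncated tree sum is the truncated zeta value
    of a convergent combination of words. *)
Lemma bounded_ttree (t : vtree) : conv_vtree t ->
  exists M, forall N, ttree R (val t) N <= M.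
Proof.
move=> /flat_ptree_conv ht; eexists => N; rewrite -ltzeta_flat.
exact: ltzeta_le.
Qed.

Lemma tree_term_ge0 t k : 0 <= tree_term R t k.
Proof. by apply: prodr_ge0 => v _; rewrite invr_ge0 exprn_ge0. Qed.

Lemma summable_trees (t : vtree) : conv_vtree t ->
  summable (tree_dom t) (fun k => (tree_term R t k)%:E).
Proof.
move=> ht; rewrite /summable.
under eq_esum => k _.
  rewrite gee0_abs; last by rewrite lee_fin tree_term_ge0.
  over.
rewrite esum_tree_dom; have [M hM] := bounded_ttree ht.
by case: (bounded_sup (@ttree_nondecreasing (val t)) hM).
Qed.

(** Both sides are limits of one sequence, since the truncations agree for every N by
    [ltzeta_flat]. *)
Lemma zeta_flat_tree (t : vtree) :
  conv_vtree t -> zeta R (flat_ptree R (val t)) = zetaT_tree R t.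
Proof.
move=> ht; have [M hM] := bounded_ttree ht.
have [_ h1] := bounded_sup (@ttree_nondecreasing (val t)) hM.
have h2 := cvg_ltzeta (flat_ptree_conv ht).
rewrite /zetaT_tree esum_tree_dom; apply: cvg_unique h1.
  exact: Rhausdorff.
apply: cvg_trans h2; apply: near_eq_cvg; apply: nearW => N.
exact: ltzeta_flat.
Qed.

Lemma zeta_flat x : Tree_conv R x -> zeta R (flat R x) = zetaT R x.
Proof.
move=> /lspan_basP hx; rewrite /flat /zeta linear_lin_ext.
rewrite /zetaT /lin_ext big_seq [RHS]big_seq; apply: eq_bigr => t /hx ht.
by congr (_ *: _); apply: zeta_flat_tree.
Qed.

(** [ev_gen] sets the unit to 1 because its region is empty, whereas [zeta_word] sums over the
    single empty chain; the two values have to be compared. *)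
Lemma zeta_word_nil : zeta_word R [::] = 1.
Proof.
rewrite /zeta_word esum_chains.
have [_ h] := bounded_sup (@tzeta_nondecreasing R [::])
  (fun N => tzeta_le2 R N (w := [::]) isT).
by apply: cvg_unique h _; [exact: Rhausdorff | exact: cvg_cst].
Qed.

Lemma ev_zetaFS x : ev R (zetaFS R x) = zeta R x.
Proof.
rewrite /ev /zetaFS coords_lin_ext; last exact: fs_gen_inj.
apply: eq_lin_ext => w; rewrite /ev_gen /fs_region /zeta_word.
by case: eqP => // ->; rewrite -/(zeta_word R [::]) zeta_word_nil.
Qed.

End Diagram.

(** The two summability clauses certify that [fine], through which [zeta], [ev] and [zetaT] are
    defined, returns genuine sums on convergent generators and not a default value. *)
Theorem corollary4p12 (R : realType) :
  [/\ (forall w : word, conv_word w ->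
         summable (chains (size w)) (fun n => (fseries_prod R w n)%:E)),
      (forall t : vtree, conv_vtree t ->
         summable (tree_dom t) (fun k => (tree_term R t k)%:E)),
      [/\ set_fun (Tridend_conv R) (Tree_conv R) (iota_map R),
          set_fun (Tree_conv R) (Words_conv R) (flat R),
          set_fun (Tridend_conv R) (Words_conv R) (Psi R),
          set_fun (Tridend_conv R) (S_conv R) (zetaTri R)
        & set_fun (Words_conv R) (S_conv R) (zetaFS R)]
    & [/\ {in Tridend_conv R, flat R \o iota_map R =1 Psi R},
          {in Tridend_conv R, zetaFS R \o Psi R =1 zetaTri R},
          {in Tree_conv R, zeta R \o flat R =1 zetaT R}
        & {in Words_conv R, ev R \o zetaFS R =1 zeta R}]].
Proof.
split.
- exact: summable_words.
- exact: summable_trees.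
- split.
  + exact: iota_conv.
  + exact: flat_conv.
  + by move=> x hx; rewrite PsiE; exact: flat_conv (iota_conv hx).
  + by move=> x hx; rewrite zetaTriE; exact: zetaFS_conv (flat_conv (iota_conv hx)).
  + exact: zetaFS_conv.
- split.
  + by move=> x _; rewrite PsiE.
  + by move=> x _; rewrite zetaTriE /= PsiE.
  + by move=> x hx; apply: zeta_flat; apply: set_mem.
  + by move=> x _; apply: ev_zetaFS.
Qed.
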